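(* Let $k$ be a field, let $m\le n$ be non-negative integers, let $X=\{x_0,\ldots,x_m\}$ and $Y=\{y_0,\ldots,y_n\}$ be distinct sets of indeterminates, and let $R=k[X,Y]$ be the polynomial ring in all these indeterminates. Let $$f=\sum_{i=0}^m x_it^i\quad\text{and}\quad g=\sum_{j=0}^n y_jt^j$$ be the corresponding generic polynomials in $R[t]$. Set $I=c(f)c(g)$ and $J=c(fg)$. Then: (a) $J$ is a minimal reduction of $I$, $\ell(I)=m+n+1$, and $r_J(I)=m$. (b) The polynomials $h_q=\sum_{i+j=q}x_iy_j$, $0\le q\le m+n$ (the sum being over $0\le i\le m$, $0\le j\le n$ with $i+j=q$), are algebraically independent over $k$, and $k[h_0,\ldots,h_{m+n}]$ is a Noether normalization of $k[x_iy_j \mid 0\le i\le m,\ 0\le j\le n]$. In particular, the factor $c(g)^m$ in the content formula $c(fg)c(g)^m=c(f)c(g)^{m+1}$ is sharp; that is, for these generic $f,g$ the equality $c(fg)c(g)^r=c(f)c(g)^{r+1}$ does not hold for any integer $0\le r<m$.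
   Context: For a commutative ring $R$ and a polynomial $f=a_0+\cdots+a_mt^m\in R[t]$, the content $c(f)$ is the ideal $(a_0,\ldots,a_m)$ of $R$. The content formula (Dedekind--Mertens) states $c(fg)c(g)^m=c(f)c(g)^{m+1}$ for polynomials $f,g$ with $\deg f=m$. A reduction of an ideal $I$ in a Noetherian ring is an ideal $J\subset I$ such that $I^{r+1}=JI^r$ for some non-negative integer $r$; the smallest such $r$ is the reduction number $r_J(I)$ of $I$ relative to $J$. A reduction is minimal if it does not properly contain another reduction of $I$. For a homogeneous ideal $I$ of the polynomial ring $R=k[X,Y]$ with homogeneous maximal ideal $\mathfrak m=(X,Y)$, the special fiber of the Rees algebra $R[It]$ is $\mathcal F(I)=R[It]\otimes_R R/\mathfrak m$; its Krull dimension is the analytic spread $\ell(I)$. A Noether normalization of a finitely generated $k$-algebra $B$ is a polynomial subring $A\subset B$ over $k$ (generated by algebraically independent elements) over which $B$ is a finitely generated module. *)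

(* Defs.v *)
From HB Require Import structures.
From mathcomp Require Import all_boot all_order all_algebra.
From mathcomp Require Import boolp.
From mathcomp Require Import mpoly.

Set Implicit Arguments.
Unset Strict Implicit.
Unset Printing Implicit Defensive.

Import GRing.Theory.

Local Open Scope ring_scope.

(* Ideals are boolean predicates (made so by [asbool]), as in ring_quotient;   *)
(* two ideals are the same when they are related by [=i].                      *)
Section Ideals.
Variable R : comNzRingType.
Implicit Types I J K S : {pred R}.

(* Unlike [idealr_closed], this does not exclude the unit ideal.               *)
Definition ideal_closed I : Prop :=
  0 \in I /\ forall a, {in I &, forall u v, a * u + v \in I}.

Definition ideal_gen S : {pred R} := fun x =>
  `[< exists2 s : seq (R * R), {in s, forall ab, ab.2 \in S}
                             & x = \sum_(ab <- s) ab.1 * ab.2 >].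

Definition ideal_mul I J : {pred R} :=
  ideal_gen (fun x => `[< exists2 a, a \in I & exists2 b, b \in J & x = a * b >]).

Fixpoint ideal_exp I n : {pred R} :=
  if n is n'.+1 then ideal_mul I (ideal_exp I n') else predT.

Definition content (p : {poly R}) : {pred R} := ideal_gen (mem (p : seq R)).

Definition is_reduction J I : Prop :=
  [/\ ideal_closed J, {subset J <= I}
    & exists r, ideal_exp I r.+1 =i ideal_mul J (ideal_exp I r)].

Definition is_minimal_reduction J I : Prop :=
  is_reduction J I /\
  forall K, is_reduction K I -> {subset K <= J} -> K =i J.

Definition is_reduction_number J I (r : nat) : Prop :=
  ideal_exp I r.+1 =i ideal_mul J (ideal_exp I r) /\
  forall s, ideal_exp I s.+1 =i ideal_mul J (ideal_exp I s) -> (r <= s)%N.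

Lemma ideal_gen_closed S : ideal_closed (ideal_gen S).
Proof.
split; first by apply/asboolP; exists [::] => //; rewrite big_nil.
move=> a u v /asboolP[s hs ->] /asboolP[t ht ->]; apply/asboolP.
exists ([seq (a * ab.1, ab.2) | ab <- s] ++ t).
  move=> ab; rewrite mem_cat => /orP[/mapP[cd cds ->]|]; last exact: ht.
  exact: (hs cd).
rewrite big_cat big_map /= mulr_sumr; congr (_ + _).
by apply: eq_bigr => ab _; rewrite mulrA.
Qed.

Lemma mem_ideal_gen S x : x \in S -> x \in ideal_gen S.
Proof.
move=> xS; apply/asboolP; exists [:: (1, x)]; last by rewrite big_seq1 mul1r.
by move=> ab; rewrite inE => /eqP->.
Qed.

Lemma ideal_gen_min S I : ideal_closed I -> {subset S <= I} ->
  {subset ideal_gen S <= I}.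
Proof.
move=> [I0 IM] SI x /asboolP[s hs ->].
elim: s hs => [|ab s IHs] hs; first by rewrite big_nil.
rewrite big_cons; apply: IM; first by apply: SI; apply: hs; rewrite mem_head.
by apply: IHs => cd cds; apply: hs; rewrite inE cds orbT.
Qed.

Lemma ideal_exp_closed I n : ideal_closed (ideal_exp I n).
Proof. by case: n => [|n]; [split | exact: ideal_gen_closed]. Qed.

Lemma ideal_expM I i j x y :
  x \in ideal_exp I i -> y \in ideal_exp I j -> x * y \in ideal_exp I (i + j).
Proof.
elim: i x => [|i IHi] x xI yI.
  have [I0 IM] := ideal_exp_closed I j.
  by rewrite -[x * y]addr0; apply: IM.
have [I0 IM] := ideal_exp_closed I (i.+1 + j).
have cl : ideal_closed (fun z => z * y \in ideal_exp I (i.+1 + j)).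
  split=> [|a u v hu hv]; first by rewrite unfold_in mul0r.
  by rewrite unfold_in mulrDl -mulrA; apply: IM.
apply: (ideal_gen_min cl _ xI) => _ /asboolP[a aI [b bI ->]].
rewrite unfold_in -mulrA; apply: mem_ideal_gen; apply/asboolP.
by exists a => //; exists (b * y) => //; apply: IHi.
Qed.

End Ideals.

(* The Rees algebra R[It], as the R-subalgebra of R[t] of the polynomials      *)
(* whose coefficient of t^i lies in I^i.                                       *)
Section Rees.
Variables (R : comNzRingType) (I : {pred R}).

Definition rees_pred : {pred {poly R}} :=
  fun p => `[< forall i, p`_i \in ideal_exp I i >].

Lemma rees_subalg_closed : subalg_closed rees_pred.
Proof.
split.
- apply/asboolP => -[|i] //; rewrite coef1.
  by case: (ideal_exp_closed I i.+1).
- move=> a u v /asboolP hu /asboolP hv; apply/asboolP => i.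
  by rewrite coefD coefZ; apply: (ideal_exp_closed I i).2.
- move=> u v /asboolP hu /asboolP hv; apply/asboolP => i.
  have [I0 IM] := ideal_exp_closed I i.
  rewrite coefM; apply: (big_ind (fun z => z \in ideal_exp I i)) => //.
    by move=> x y xI yI; rewrite -[x]mul1r; apply: IM.
  move=> j _; have := ideal_expM (hu j) (hv (i - j)%N).
  by rewrite subnKC // -ltnS.
Qed.

HB.instance Definition _ :=
  GRing.isSubalgClosed.Build R {poly R} rees_pred rees_subalg_closed.

Record rees := Rees { rees_val : {poly R}; _ : rees_val \in rees_pred }.

HB.instance Definition _ := [isSub for rees_val].
HB.instance Definition _ := [Choice of rees by <:].
HB.instance Definition _ := [SubChoice_isSubAlgebra of rees by <:].
HB.instance Definition _ := [SubNzRing_isSubComNzRing of rees by <:].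
End Rees.

(* The special fiber R[It] (x)_R R/m, as the quotient R[It] / m R[It] by the   *)
(* extension of m to R[It]; [m] is a proper ideal.                             *)
Section SpecialFiber.
Variables (R : comNzRingType) (I : {pred R}) (m : idealr R).

Definition fiber_ideal : {pred rees I} :=
  ideal_gen (fun z => `[< exists2 a, a \in m & z = a%:A >]).

Lemma fiber_idealr_closed : idealr_closed fiber_ideal.
Proof.
have [F0 FM] : ideal_closed fiber_ideal by apply: ideal_gen_closed.
split=> //; apply/negP => F1.
have cl : ideal_closed (fun z : rees I => (rees_val z)`_0 \in m).
  split=> [|a u v hu hv]; first by rewrite unfold_in coef0 rpred0.
  by rewrite unfold_in coefD coef0M rpredD // idealMr.
suff : (1 : rees I) \in (fun z : rees I => (rees_val z)`_0 \in m).
  by rewrite unfold_in coef1 eqxx idealr1.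
apply: (ideal_gen_min cl _ F1) => _ /asboolP[a am ->].
by rewrite unfold_in /= coefZ coef1 eqxx mulr1.
Qed.

HB.instance Definition _ := isIdealr.Build (rees I) fiber_ideal fiber_idealr_closed.

Definition special_fiber := {ideal_quot fiber_ideal}.
HB.instance Definition _ := GRing.ComNzRing.on special_fiber.

End SpecialFiber.

Definition prime_chain (A : comNzRingType) d (P : 'I_d.+1 -> prime_idealr A) :=
  forall i j : 'I_d.+1, (i < j)%N ->
    {subset P i <= P j} /\ ~ {subset P j <= P i}.

Definition has_krull_dim (A : comNzRingType) (d : nat) : Prop :=
  (exists P : 'I_d.+1 -> prime_idealr A, prime_chain P) /\
  forall e (P : 'I_e.+1 -> prime_idealr A), prime_chain P -> (e <= d)%N.

Section Subalgebras.
Variables (k : fieldType) (S : comAlgType k).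
Implicit Types A B G : {pred S}.

Definition gen_subalg G : {pred S} := fun a =>
  `[< forall A, subalg_closed A -> {subset G <= A} -> a \in A >].

Definition alg_independent d (z : 'I_d -> S) : Prop :=
  forall p : {mpoly k[d]}, mmap (in_alg S) z p = 0 -> p = 0.

Definition finite_over A B : Prop :=
  exists l (b : 'I_l -> S), (forall i, b i \in B) /\
    forall x, x \in B ->
      exists2 c : 'I_l -> S, forall i, c i \in A & x = \sum_i c i * b i.

Definition is_noether_normalization A B : Prop :=
  [/\ exists d (z : 'I_d -> S),
        alg_independent z /\ A =i gen_subalg (mem (codom z)),
      {subset A <= B}
    & finite_over A B].

End Subalgebras.

Section IrrelevantIdeal.
Variables (k : fieldType) (N : nat).

Definition irrelevant_ideal : {pred {mpoly k[N]}} :=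
  ideal_gen (mem (codom (fun i : 'I_N => 'X_i : {mpoly k[N]}))).

Lemma irrelevant_idealr_closed : idealr_closed irrelevant_ideal.
Proof.
have [F0 FM] : ideal_closed irrelevant_ideal by apply: ideal_gen_closed.
split=> //; apply/negP => F1.
have cl : ideal_closed (fun p : {mpoly k[N]} => p@_0%MM == 0).
  split=> [|a u v /eqP hu /eqP hv]; first by rewrite unfold_in mcoeff0.
  rewrite unfold_in mcoeffD hv addr0 /=.
  by rewrite rmorphM /= hu mulr0.
suff : (1 : {mpoly k[N]}) \in (fun p : {mpoly k[N]} => p@_0%MM == 0).
  by rewrite unfold_in mcoeff1 eqxx oner_eq0.
apply: (ideal_gen_min cl _ F1) => _ /codomP[i ->].
by rewrite unfold_in mcoeffX mnm1_eq0.
Qed.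

HB.instance Definition _ :=
  isIdealr.Build {mpoly k[N]} irrelevant_ideal irrelevant_idealr_closed.

Definition has_analytic_spread (I : {pred {mpoly k[N]}}) (l : nat) : Prop :=
  has_krull_dim (special_fiber I irrelevant_ideal) l.

End IrrelevantIdeal.

(* k[X,Y] has variables x_0, ..., x_m followed by y_0, ..., y_n.               *)
Section Generic.
Variables (k : fieldType) (m n : nat).

Local Notation kXY := {mpoly k[m.+1 + n.+1]}.

Definition xvar (i : 'I_m.+1) : kXY := 'X_(lshift n.+1 i).
Definition yvar (j : 'I_n.+1) : kXY := 'X_(rshift m.+1 j).

Definition gen_f : {poly kXY} := \sum_(i < m.+1) (xvar i)%:P * 'X^i.
Definition gen_g : {poly kXY} := \sum_(j < n.+1) (yvar j)%:P * 'X^j.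

Definition hpoly (q : 'I_(m + n).+1) : kXY :=
  \sum_(i < m.+1) \sum_(j < n.+1 | (i + j == q)%N) xvar i * yvar j.

Definition xyprod (ij : 'I_m.+1 * 'I_n.+1) : kXY := xvar ij.1 * yvar ij.2.

End Generic.

(* Main.v *)
(* Over any commutative ring, Northcott's induction for Dedekind-Mertens      *)
(* writes x_i y_(j_0) ... y_(j_m) as an integral combination of products      *)
(* h_q y_(j_1) ... y_(j_m); this gives both I^(m+1) = J I^m and the           *)
(* finiteness of k[x_i y_j] over k[h].                                        *)
(* Sharpness: x_0^d y_n^d is not in J for d <= m. Substituting products of    *)
(* linear forms in s_1, ..., s_(m+n) for f and g turns the h_q into symmetric *)
(* polynomials, so a suitable alternating sum over the symmetric group        *)
(* commutes with them; it vanishes in bidegree (m-1, m-1) for degree reasons, *)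
(* but sends x_0^m y_n^m to a Vandermonde determinant.                        *)
(* Dimension: if a_s lies in P_(s+1) but not in P_s along a chain of primes,  *)
(* the monomials in the a_s are linearly independent. With the chain obtained *)
(* by killing x_m, ..., x_1, y_n, ..., y_0 successively this proves that the  *)
(* h_q are independent, and comparing with the number of monomials x^a y^b,   *)
(* |a| = |b| <= D, it bounds the length of every chain in the special fiber.  *)
(* Minimality: a reduction K inside J is compared with J separately at the    *)
(* origin, along x = 0 and along y = 0.                                       *)

Require Import Defs.
From HB Require Import structures.
From mathcomp Require Import all_boot all_order perm all_algebra fieldext.
From mathcomp Require Import boolp.
From mathcomp Require Import mpoly.
From mathcomp Require Import zify ring.

Set Implicit Arguments.
Unset Strict Implicit.
Unset Printing Implicit Defensive.

Import GRing.Theory.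

Local Open Scope ring_scope.

(** * Ideals and the Dedekind-Mertens formula *)

(** All upper bounds come from one exchange: by [dedekind_mertens_words], a product of m+1 letters
    x_i y_j is an integral combination of products of some h_q with m letters. Read as membership in
    J I^m this is the reduction; read inside k[x_i y_j] it says that the words of length at most m
    generate over k[h].

    The lower bounds come from one element. [xy_power_notin_content] keeps x_0^(r+1) y_n^(r+1) out
    of J for r < m, while it lies in I^(r+1) and in c(f) c(g)^(r+1). A functional vanishing on J
    detects it: split f and g into linear factors in m+n variables, so that each h_q becomes
    elementary symmetric up to the grading variables, and antisymmetrise. What a multiple of h_q
    leaves over has degrees too small for m+n distinct exponents.

    Prime chains serve twice. Elements separating the steps of a chain satisfy no polynomial
    relation over k ([prime_tower_independent]), whence the independence of the h_q; and an algebra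
    filtered by at most (D+1)^N generators at level D has no chain of length above N
    ([prime_tower_bound]). A monomial of I^d t^d is determined by the exponents of all variables
    except y_n, so N = m+n+1 works for the special fiber, and killing variables one by one reaches
    this length.

    For minimality let K inside J be a reduction. Modulo [irr] J the h_q must come from K: otherwise
    a nonzero lam in k^(m+n+1) annihilates the degree 2 forms of K, lam(t) factors as f0 g0 over an
    extension field, and along (u f0, u g0) K vanishes to higher order than I, against I^(r+1) = K
    I^r ([arc_contradiction]). Where some x_i or y_j is inverted, I is generated by variables and
    has no proper reduction, so powers of all variables carry J into K ([variable_power_mem]). Hence
    J = K + [irr]^s J for every s, and [irr]^s J lies in K for large s. *)

Section IdealClosed.
Variables (R : comNzRingType) (I : {pred R}).
Hypothesis hI : ideal_closed I.

Lemma ideal0 : 0 \in I. Proof. exact: hI.1. Qed.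

Lemma idealD u v : u \in I -> v \in I -> u + v \in I.
Proof. by move=> hu hv; rewrite -[u]mul1r; apply: hI.2. Qed.

Lemma idealMl a u : u \in I -> a * u \in I.
Proof. by move=> hu; rewrite -[_ * _]addr0; apply: hI.2 => //; apply: ideal0. Qed.

Lemma idealMr_closed a u : u \in I -> u * a \in I.
Proof. by rewrite mulrC; apply: idealMl. Qed.

Lemma idealN u : u \in I -> - u \in I.
Proof. by move=> hu; rewrite -mulN1r; apply: idealMl. Qed.

Lemma idealB u v : u \in I -> v \in I -> u - v \in I.
Proof. by move=> hu hv; apply: idealD => //; apply: idealN. Qed.

Lemma ideal_sum (T : Type) (r : seq T) (P : pred T) (F : T -> R) :
  (forall t, P t -> F t \in I) -> \sum_(t <- r | P t) F t \in I.
Proof.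
by move=> hF; apply: (big_ind (fun z => z \in I)) => //; [apply: ideal0|apply: idealD].
Qed.

End IdealClosed.

Section IdealOperations.
Variable R : comNzRingType.
Implicit Types I J Q S T : {pred R}.

Lemma ideal_closed_comp Q b : ideal_closed Q -> ideal_closed (fun z => z * b \in Q).
Proof.
move=> hQ; split=> [|a u v hu hv]; rewrite !unfold_in.
  by rewrite mul0r; apply: ideal0.
by rewrite mulrDl -mulrA; apply: idealD => //; apply: idealMl.
Qed.

Lemma ideal_mul_mem I J a b : a \in I -> b \in J -> a * b \in ideal_mul I J.
Proof.
move=> aI bJ; apply: mem_ideal_gen; apply/asboolP.
by exists a => //; exists b.
Qed.

Lemma ideal_mul_min I J Q : ideal_closed Q ->
  (forall a b, a \in I -> b \in J -> a * b \in Q) -> {subset ideal_mul I J <= Q}.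
Proof.
by move=> hQ h; apply: ideal_gen_min => // _ /asboolP[a aI [b bJ ->]]; apply: h.
Qed.

Lemma ideal_mul_closed I J : ideal_closed (ideal_mul I J).
Proof. exact: ideal_gen_closed. Qed.

End IdealOperations.

Section DedekindMertens.
Variables (A : comNzRingType) (x y : nat -> A) (n : nat).
Hypothesis y_gt : forall j, (n < j)%N -> y j = 0.

(** The coefficient of t^q in f g, for coefficient sequences indexed by all of nat; the guard is
    there because [q - i] truncates to 0. *)
Definition conv_coef m q := \sum_(i < m.+1) if (i <= q)%N then x i * y (q - i) else 0.

Lemma conv_coefS m q : conv_coef m.+1 q =
  conv_coef m q + (if (m < q)%N then x m.+1 * y (q - m.+1) else 0).
Proof. by rewrite /conv_coef big_ord_recr. Qed.

(* Writing f = f' + x_(m+1) t^(m+1), the induction hypothesis for f' reduces  *)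
(* the claim to products x_(m+1) y_j Y, and these are handled by descending   *)
(* induction on j, since x_(m+1) y_j = h_(m+1+j) - (terms x_i y_j', j' > j).  *)
Lemma dedekind_mertens m (P : A -> Prop) :
    P 0 -> (forall u v, P u -> P v -> P (u - v)) ->
    (forall q s, size s = m -> P (conv_coef m q * \prod_(j <- s) y j)) ->
  forall i s, (i <= m)%N -> size s = m.+1 -> P (x i * \prod_(j <- s) y j).
Proof.
elim: m P => [|m IHm] P P0 PB hP i s.
  case: i s => [|//] [|j [|//]] // _ _; have := hP j [::] erefl.
  by rewrite /conv_coef big_ord1 /= subn0 big_nil mulr1 big_seq1.
have PN u : P u -> P (- u) by move=> /(PB _ _ P0); rewrite sub0r.
have PD u v : P u -> P v -> P (u + v) by move=> hu /PN/(PB _ _ hu); rewrite opprK.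
(* The induction hypothesis is used for [fun z => P (z * y j')]: words for the shorter f' have one
   letter less, and [y j'] supplies it. *)
have low j' : (forall s', size s' = m.+1 ->
      P (x m.+1 * y j' * \prod_(j <- s') y j)) ->
    forall i s', (i <= m)%N -> size s' = m.+1 -> P (x i * y j' * \prod_(j <- s') y j).
  move=> hx i' s' hi hs'.
  have := IHm (fun z => P (z * y j')); rewrite mulrAC; apply=> //.
  - by rewrite mul0r.
  - by move=> u v hu hv; rewrite mulrBl; apply: PB.
  move=> q t ht.
  have -> : conv_coef m q = conv_coef m.+1 q -
     (if (m < q)%N then x m.+1 * y (q - m.+1) else 0) by rewrite conv_coefS addrK.
  rewrite !mulrBl; apply: PB.
    by have := hP q (rcons t j'); rewrite size_rcons ht -cats1 big_cat big_seq1 mulrA; apply.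
  case: ifP => _; last by rewrite !mul0r.
  have := hx (q - m.+1 :: t)%N; rewrite /= ht big_cons => /(_ erefl).
  by congr P; rewrite -!mulrA; congr (_ * _); rewrite mulrC -mulrA.
have high k : forall j s', (n < j + k)%N -> size s' = m.+1 ->
    P (x m.+1 * y j * \prod_(j <- s') y j).
  elim: k => [|k IHk] j s' hj hs'.
    by rewrite y_gt ?mulr0 ?mul0r //; rewrite addn0 in hj.
  have := hP (m.+1 + j)%N s' hs'; rewrite conv_coefS leq_addr addKn mulrDl => hc.
  have [c hc1 ->] : exists2 c, P (c * \prod_(j <- s') y j) &
      x m.+1 * y j = conv_coef m.+1 (m.+1 + j) - c.
    exists (conv_coef m (m.+1 + j)); last by rewrite conv_coefS leq_addr addKn addrC addKr.
    rewrite /conv_coef mulr_suml; apply: (big_ind P) => // i' _.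
    have hi' : (i' <= m)%N by rewrite -ltnS.
    case: ifP => _; last by rewrite mul0r.
    apply: low => // t ht; apply: IHk => //.
    by rewrite -addSnnS in hj; apply: leq_trans hj _; rewrite leq_add2r; lia.
  by rewrite mulrBl; apply: PB => //; rewrite conv_coefS leq_addr addKn mulrDl.
have high' j s' : size s' = m.+1 -> P (x m.+1 * y j * \prod_(j <- s') y j).
  by move=> hs'; apply: (high n.+1) => //; rewrite addnS ltnS leq_addl.
case: s => [//|j s] hi [hs]; rewrite big_cons mulrA.
move: hi; rewrite leq_eqVlt => /predU1P[->|hi]; first exact: high'.
by apply: low => // t; apply: high'.
Qed.

End DedekindMertens.

(** * Monomials in the products x_i y_j *)

Section Words.
Variables (k : fieldType) (m n : nat).
Local Notation kXY := {mpoly k[m.+1 + n.+1]}.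
Local Notation letter := ('I_m.+1 * 'I_n.+1)%type.
Local Notation xv := (@xvar k m n).
Local Notation yv := (@yvar k m n).
Local Notation h := (@hpoly k m n).
Local Notation f := (gen_f k m n).
Local Notation g := (gen_g k m n).
Local Notation I := (ideal_mul (content f) (content g)).
Local Notation J := (content (f * g)).

(** Words rather than exponent vectors: the length of the word records the power of I, and letters
    can be split off or re-paired by list operations. *)
Definition word_prod (w : seq letter) : kXY := \prod_(e <- w) xyprod k e.

Lemma word_prod_cat w1 w2 : word_prod (w1 ++ w2) = word_prod w1 * word_prod w2.
Proof. by rewrite /word_prod big_cat. Qed.

Lemma word_prodE w : word_prod w =
  (\prod_(i <- unzip1 w) xv i) * (\prod_(j <- unzip2 w) yv j).
Proof. by rewrite /word_prod big_split /= !big_map. Qed.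

Lemma coef_gen_f i : f`_i = if (i < m.+1)%N then xv (inord i) else 0.
Proof.
rewrite /gen_f coef_sum; case: ifP => hi.
  rewrite (bigD1 (inord i)) //= coefCM coefXn inordK // eqxx mulr1 big1 ?addr0 // => j.
  rewrite coefCM coefXn -val_eqE /= inordK // eq_sym => /negPf->.
  by rewrite mulr0.
rewrite big1 // => j _; rewrite coefCM coefXn; case: eqP; rewrite ?mulr0 // => e.
by rewrite e ltn_ord in hi.
Qed.

Lemma coef_gen_g j : g`_j = if (j < n.+1)%N then yv (inord j) else 0.
Proof.
rewrite /gen_g coef_sum; case: ifP => hj.
  rewrite (bigD1 (inord j)) //= coefCM coefXn inordK // eqxx mulr1 big1 ?addr0 // => i.
  rewrite coefCM coefXn -val_eqE /= inordK // eq_sym => /negPf->.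
  by rewrite mulr0.
rewrite big1 // => i _; rewrite coefCM coefXn; case: eqP; rewrite ?mulr0 // => e.
by rewrite e ltn_ord in hj.
Qed.

Lemma coef_gen_f_ord (i : 'I_m.+1) : f`_i = xv i.
Proof. by rewrite coef_gen_f ltn_ord inord_val. Qed.

Lemma coef_gen_g_ord (j : 'I_n.+1) : g`_j = yv j.
Proof. by rewrite coef_gen_g ltn_ord inord_val. Qed.

Lemma coef_gen_fg (q : nat) : (f * g)`_q =
  \sum_(i < m.+1) \sum_(j < n.+1 | (i + j == q)%N) xv i * yv j.
Proof.
rewrite /gen_f mulr_suml coef_sum; apply: eq_bigr => i _.
rewrite -mulrA coefCM /gen_g mulr_sumr coef_sum mulr_sumr [RHS]big_mkcond /=.
apply: eq_bigr => j _; rewrite mulrCA -exprD coefCM coefXn eq_sym.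
by case: ifP => _; rewrite ?mulr1 ?mulr0.
Qed.

Lemma coef_gen_fg_ord (q : 'I_(m + n).+1) : (f * g)`_q = h q.
Proof. exact: coef_gen_fg. Qed.

Lemma coef_gen_fg_gt q : (m + n < q)%N -> (f * g)`_q = 0.
Proof.
move=> hq; rewrite coef_gen_fg big1 // => i _; apply: big1 => j /eqP e.
by have := ltn_ord i; have := ltn_ord j; lia.
Qed.

Lemma coef_gen_fg_conv q : (f * g)`_q = conv_coef (fun i => f`_i) (fun j => g`_j) m q.
Proof.
rewrite coefM /conv_coef; pose F i := if (i <= q)%N then f`_i * g`_(q - i) else 0.
have trunc N N' : (N <= N')%N -> (forall i, (N <= i)%N -> F i = 0) ->
    \sum_(0 <= i < N') F i = \sum_(i < N) F i.
  move=> hN hF; rewrite (big_cat_nat (n := N)) //= big_mkord.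
  by rewrite [X in _ + X]big_nat [X in _ + X]big1 ?addr0 // => i /andP[/hF].
rewrite -[RHS](trunc _ (q.+1 + m.+1)%N) ?leq_addl //; last first.
  by move=> i hi; rewrite /F coef_gen_f ltnNge hi /= mul0r if_same.
rewrite (trunc q.+1) ?leq_addr //; last by move=> i hi; rewrite /F leqNgt hi.
by apply: eq_bigr => i _; rewrite /F -ltnS ltn_ord.
Qed.

Lemma content_mem (p : {poly kXY}) i : p`_i \in content p.
Proof.
have [hi|hi] := ltnP i (size p).
  by apply: mem_ideal_gen; apply: mem_nth.
by rewrite nth_default //; apply: (ideal_gen_closed _).1.
Qed.

Lemma content_min (p : {poly kXY}) Q : ideal_closed Q ->
  (forall i, p`_i \in Q) -> {subset content p <= Q}.
Proof.
move=> hQ hp; apply: ideal_gen_min => // a /= ap.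
by rewrite -(nth_index 0 ap); apply: hp.
Qed.

Lemma xvar_content i : xv i \in content f.
Proof. by rewrite -coef_gen_f_ord content_mem. Qed.

Lemma yvar_content j : yv j \in content g.
Proof. by rewrite -coef_gen_g_ord content_mem. Qed.

Lemma hpoly_content q : h q \in J.
Proof. by rewrite -coef_gen_fg_ord content_mem. Qed.

Lemma content_f_min Q : ideal_closed Q -> (forall i, xv i \in Q) -> {subset content f <= Q}.
Proof.
move=> hQ hx; apply: content_min => // i; rewrite coef_gen_f.
by case: ifP => _ //; apply: hQ.1.
Qed.

Lemma content_g_min Q : ideal_closed Q -> (forall j, yv j \in Q) -> {subset content g <= Q}.
Proof.
move=> hQ hy; apply: content_min => // j; rewrite coef_gen_g.
by case: ifP => _ //; apply: hQ.1.
Qed.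

Lemma content_fg_min Q : ideal_closed Q -> (forall q, h q \in Q) -> {subset J <= Q}.
Proof.
move=> hQ hh; apply: content_min => // q.
have [hq|hq] := ltnP q (m + n).+1; last by rewrite coef_gen_fg_gt ?hQ.1.
by rewrite -[q]/(val (Ordinal hq)) coef_gen_fg_ord.
Qed.

Lemma xyprod_mem e : xyprod k e \in I.
Proof. by apply: ideal_mul_mem; [apply: xvar_content|apply: yvar_content]. Qed.

Lemma I_min Q : ideal_closed Q -> (forall e, xyprod k e \in Q) -> {subset I <= Q}.
Proof.
move=> hQ hxy; apply: ideal_mul_min => // a b af bg.
suff: a \in (fun z => z * b \in Q) by rewrite unfold_in.
move: a af; apply: content_f_min; first exact: ideal_closed_comp.
move=> i; rewrite unfold_in mulrC.
suff: b \in (fun z => z * xv i \in Q) by rewrite unfold_in.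
move: b bg; apply: content_g_min; first exact: ideal_closed_comp.
by move=> j; rewrite unfold_in mulrC; apply: (hxy (i, j)).
Qed.

Lemma word_prod_mem w : word_prod w \in ideal_exp I (size w).
Proof.
elim: w => [|e w IHw] //; rewrite /word_prod big_cons.
by apply: ideal_mul_mem => //; apply: xyprod_mem.
Qed.

Lemma I_exp_min d Q : ideal_closed Q ->
  (forall w, size w = d -> word_prod w \in Q) -> {subset ideal_exp I d <= Q}.
Proof.
elim: d Q => [|d IHd] Q hQ hw.
  move=> a _; rewrite -[a]mulr1; apply: idealMl => //.
  by have := hw [::] erefl; rewrite /word_prod big_nil.
apply: ideal_mul_min => // a b aI.
rewrite mulrC; suff h1 : {subset ideal_exp I d <= (fun z => z * a \in Q)} by exact: h1.
apply: IHd; first exact: ideal_closed_comp.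
move=> w sw; rewrite unfold_in mulrC.
suff: a \in (fun z => z * word_prod w \in Q) by rewrite unfold_in.
move: a aI; apply: I_min; first exact: ideal_closed_comp.
move=> e; rewrite unfold_in.
by have := hw (e :: w); rewrite /= sw /word_prod big_cons; apply.
Qed.

Lemma hpoly_I q : h q \in I.
Proof.
apply: ideal_sum; first exact: ideal_mul_closed.
move=> i _; apply: ideal_sum; first exact: ideal_mul_closed.
by move=> j _; apply: (xyprod_mem (i, j)).
Qed.

Lemma J_sub_I : {subset J <= I}.
Proof. by apply: content_fg_min; [apply: ideal_mul_closed|apply: hpoly_I]. Qed.

(** The x-letters after the first form an inert factor [X]; only the y-letters take part in the
    exchange. [P] stays arbitrary because it is used both for J I^m and for the k[h]-module
    generated by short words. *)
Lemma dedekind_mertens_words (P : kXY -> Prop) :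
    P 0 -> (forall u v, P u -> P v -> P (u - v)) ->
    (forall q w, size w = m -> P (h q * word_prod w)) ->
  forall w, size w = m.+1 -> P (word_prod w).
Proof.
move=> P0 PB hP [//|[i j] w] /= [sw].
have prodg (s : seq 'I_n.+1) : \prod_(j <- map val s) g`_j = \prod_(j <- s) yv j.
  by rewrite big_map; apply: eq_bigr => j' _; apply: coef_gen_g_ord.
set X := \prod_(i <- unzip1 w) xv i.
have -> : word_prod ((i, j) :: w) = f`_i * (\prod_(j <- map val (j :: unzip2 w)) g`_j) * X.
  by rewrite prodg word_prodE coef_gen_f_ord /= !big_cons -/X; ring.
apply: (@dedekind_mertens _ (fun i => f`_i) (fun j => g`_j) n _ m
  (fun z => P (z * X))) => //.
- by move=> j' hj'; rewrite coef_gen_g ltnNge hj'.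
- by rewrite mul0r.
- by move=> u v hu hv; rewrite mulrBl; apply: PB.
- move=> q s ss; rewrite -coef_gen_fg_conv.
  have [hq|hq] := ltnP q (m + n).+1; last by rewrite coef_gen_fg_gt ?mul0r.
  (* Indices at most n are paired by [zip] with the x-letters of [w], equal in number; an index
     above n makes the product zero. *)
  have [hs|] := boolP (all (fun j => (j < n.+1)%N) s).
    have -> : s = map val (map (@inord n) s).
      rewrite -map_comp map_id_in // => j' /(allP hs) hj'; exact: inordK.
    set s' := map _ s.
    have := hP (Ordinal hq) (zip (unzip1 w) s').
    rewrite word_prodE size_zip size_map size_map sw ss minnn => /(_ erefl).
    rewrite unzip1_zip ?unzip2_zip ?size_map ?sw ?ss //.
    rewrite -[q]/(val (Ordinal hq)) coef_gen_fg_ord prodg /X.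
    by congr P; ring.
  rewrite -has_predC => /hasP[j' js /= hj'].
  rewrite (big_rem j') //= coef_gen_g (negPf hj') mul0r mulr0 mul0r //.
- by rewrite -ltnS.
- by rewrite size_map /= size_map sw.
Qed.

Lemma I_exp_reduction : ideal_exp I m.+1 =i ideal_mul J (ideal_exp I m).
Proof.
move=> z; apply/idP/idP; last first.
  move: z; apply: ideal_mul_min; first exact: ideal_exp_closed.
  move=> a b aJ bI; rewrite -[m.+1]/(1 + m)%N; apply: ideal_expM => //.
  by rewrite -[a]mulr1; apply: ideal_mul_mem => //; apply: J_sub_I.
have cl := ideal_mul_closed J (ideal_exp I m).
move: z; apply: (I_exp_min cl).
apply: (@dedekind_mertens_words (fun z => z \in ideal_mul J (ideal_exp I m))).
- exact: cl.1.
- by move=> u v; apply: idealB.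
move=> q w sw; apply: ideal_mul_mem; first exact: hpoly_content.
by have := word_prod_mem w; rewrite sw.
Qed.

End Words.
(** * Sharpness of the reduction number *)

Lemma mpoly_subring_ind (R : comNzRingType) (N : nat) (P : {mpoly R[N]} -> Prop) :
    (forall c, P c%:MP) -> (forall i, P 'X_i) ->
    (forall p q, P p -> P q -> P (p + q)) -> (forall p q, P p -> P q -> P (p * q)) ->
  forall p, P p.
Proof.
move=> PC PX PD PM p; rewrite [p]mpolyE.
elim/big_ind: _ => [|q1 q2|mon _]; [by rewrite -mpolyC0|exact: PD|].
 rewrite -mul_mpolyC; apply: (PM) => //; rewrite mpolyXE_id.
have P1 : P 1 by rewrite -mpolyC1.
elim/big_ind: _ => [//|q1 q2|i _]; first exact: (PM).
elim: (mon i) => [|e IHe]; first by rewrite expr0.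
by rewrite exprS; apply: PM.
Qed.

Section DegreeBound.
Variables (R : comNzRingType) (N : nat).
Implicit Types (p q : {mpoly R[N]}) (D : 'I_N -> nat).

Definition deg_bounded D p := forall mon, mon \in msupp p -> forall i, (mon i <= D i)%N.

Lemma deg_bounded0 D : deg_bounded D 0.
Proof. by move=> mon; rewrite msupp0. Qed.

Lemma deg_boundedC D c : deg_bounded D c%:MP.
Proof.
by move=> mon; rewrite msuppC; case: eqP => // _; rewrite inE => /eqP-> i; rewrite mnm0E.
Qed.

Lemma deg_boundedX (i : 'I_N) : deg_bounded (fun j => (i == j) : nat) 'X_i.
Proof. by move=> mon /mem_msuppXP <- j; rewrite mnm1E. Qed.

Lemma deg_boundedD D p q : deg_bounded D p -> deg_bounded D q -> deg_bounded D (p + q).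
Proof. by move=> hp hq mon /msuppD_le; rewrite mem_cat => /orP[/hp|/hq]. Qed.

Lemma deg_boundedM D D' p q : deg_bounded D p -> deg_bounded D' q ->
  deg_bounded (fun i => D i + D' i)%N (p * q).
Proof.
move=> hp hq mon /msuppM_le/allpairsP[[m1 m2] /= [h1 h2 ->]] i.
by rewrite mnmDE leq_add ?hp ?hq.
Qed.

Lemma deg_bounded_sum D (T : Type) (r : seq T) (P : pred T) F :
  (forall t, P t -> deg_bounded D (F t)) -> deg_bounded D (\sum_(t <- r | P t) F t).
Proof.
by move=> hF; apply: big_ind => //; [apply: deg_bounded0|apply: deg_boundedD].
Qed.

Lemma deg_boundedW D D' p : (forall i, (D i <= D' i)%N) ->
  deg_bounded D p -> deg_bounded D' p.
Proof. by move=> hD hp mon hmon i; apply: leq_trans (hD i); apply: hp. Qed.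

(** Its coefficients are the elementary symmetric polynomials in the variables listed in [r];
    concatenating lists multiplies the polynomials. *)
Definition linear_prod (r : seq 'I_N) : {poly {mpoly R[N]}} :=
  \prod_(i <- r) (1 + 'X_i *: 'X).

Lemma coef_linear_prod_cons i r e : (linear_prod (i :: r))`_e =
  (linear_prod r)`_e + (if e is e'.+1 then 'X_i * (linear_prod r)`_e' else 0).
Proof.
rewrite /linear_prod big_cons mulrDl mul1r coefD -scalerAl coefZ coefXM.
by case: e => //=; rewrite mulr0.
Qed.

Lemma linear_prod_deg_bounded r e :
  deg_bounded (fun i => count_mem i r) (linear_prod r)`_e.
Proof.
elim: r e => [|i r IHr] e.
  by rewrite /linear_prod big_nil coef1 -mpolyC_nat; apply: deg_boundedC.
rewrite coef_linear_prod_cons; apply: deg_boundedD.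
  by apply: deg_boundedW (IHr e) => j /=; rewrite leq_addl.
case: e => [|e]; first exact: deg_bounded0.
by apply: deg_boundedW (deg_boundedM (@deg_boundedX i) (IHr e)).
Qed.

Lemma linear_prod_perm r s : perm_eq r s -> linear_prod r = linear_prod s.
Proof. by move=> rs; apply: perm_big. Qed.

Lemma linear_prod_cat r s : linear_prod (r ++ s) = linear_prod r * linear_prod s.
Proof. by rewrite /linear_prod big_cat. Qed.

Lemma linear_prod_coef0 r : (linear_prod r)`_0 = 1.
Proof.
elim: r => [|i r IHr]; first by rewrite /linear_prod big_nil coef1.
by rewrite coef_linear_prod_cons addr0.
Qed.

Lemma linear_prod_coef_gt r e : (size r < e)%N -> (linear_prod r)`_e = 0.
Proof.
elim: r e => [|i r IHr] e /=; first by case: e => // e; rewrite /linear_prod big_nil coef1.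
case: e => // e he; rewrite coef_linear_prod_cons !IHr ?mulr0 ?addr0 //.
exact: ltnW.
Qed.

Lemma linear_prod_coef_size r : (linear_prod r)`_(size r) = \prod_(i <- r) 'X_i.
Proof.
elim: r => [|i r IHr]; first by rewrite linear_prod_coef0 big_nil.
by rewrite coef_linear_prod_cons /= linear_prod_coef_gt // add0r IHr big_cons.
Qed.

End DegreeBound.

(** * Antisymmetrisation *)

Section Alternation.
Variables (k : fieldType) (N : nat).
Local Notation S := {mpoly k[N]}.

(** Linear over symmetric polynomials, zero on monomials with a repeated exponent, and a Vandermonde
    determinant on the staircase monomial with exponents 0, ..., N-1. *)
Definition alternation (p : S) : S := \sum_(w : 'S_N) (-1) ^+ w * msym w p.

Lemma alternation0 : alternation 0 = 0.
Proof. by rewrite /alternation big1 // => w _; rewrite msym0 mulr0. Qed.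

Lemma alternationZ c p : alternation (c *: p) = c *: alternation p.
Proof.
rewrite /alternation scaler_sumr; apply: eq_bigr => w _.
by rewrite msymZ scalerAr.
Qed.

Lemma alternation_sum (T : Type) (r : seq T) (P : pred T) F :
  alternation (\sum_(t <- r | P t) F t) = \sum_(t <- r | P t) alternation (F t).
Proof.
rewrite /alternation exchange_big /=; apply: eq_bigr => w _.
by rewrite raddf_sum mulr_sumr.
Qed.

Lemma alternationM e p : e \is symmetric -> alternation (e * p) = e * alternation p.
Proof.
move=> /issymP he; rewrite /alternation mulr_sumr; apply: eq_bigr => w _.
by rewrite msymM he mulrCA.
Qed.

Lemma msymXi (w : 'S_N) i : msym w 'X_i = 'X_(w i) :> S.
Proof.
rewrite msymX; congr mpolyX; apply/mnmP => j.
by rewrite mnmE !mnm1E -(inj_eq (@perm_inj _ w)) permKV.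
Qed.

Lemma alternationX mon : alternation 'X_[mon] = \det (\matrix_(i, j) 'X_j ^+ mon i).
Proof.
rewrite /alternation /determinant; apply: eq_bigr => w _; congr (_ * _).
rewrite mpolyXE_id rmorph_prod /=.
by apply: eq_bigr => i _; rewrite mxE rmorphXn /= msymXi.
Qed.

Lemma alternationX_eq0 (mon : 'X_{1..N}) i1 i2 :
  i1 != i2 -> mon i1 = mon i2 -> alternation 'X_[mon] = 0.
Proof.
move=> ne e; rewrite alternationX (determinant_alternate ne) // => j.
by rewrite !mxE e.
Qed.

Lemma alternation_vandermonde : alternation 'X_[[multinom val i | i < N]] != 0.
Proof.
rewrite alternationX.
have -> : (\matrix_(i, j) 'X_j ^+ [multinom val i | i < N] i) =
   Vandermonde N (\row_j ('X_j : S)).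
  by apply/matrixP => i j; rewrite !mxE mnmE.
rewrite det_Vandermonde; apply/prodf_neq0 => i _; apply/prodf_neq0 => j ij.
rewrite !mxE subr_eq0; apply/eqP => /(congr1 (mcoeff U_(i)%MM)).
rewrite !mcoeffXU eqxx; case: eqP => [e|_ /esym/eqP]; last by rewrite oner_eq0.
by rewrite e ltnn in ij.
Qed.

(* N exponents below N - 1 cannot be distinct. *)
Lemma alternation_deg_bounded D p : (0 < N)%N ->
  (forall i, (D i < N.-1)%N) -> deg_bounded D p -> alternation p = 0.
Proof.
move=> N0 hD hp; rewrite [p]mpolyE alternation_sum big_seq big1 // => mon hmon.
rewrite alternationZ; have hlt i : (mon i < N.-1)%N.
  by apply: leq_ltn_trans (hD i); apply: hp.
pose F i := Ordinal (hlt i).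
have /injectiveP : ~ injective F.
  move=> /leq_card; rewrite !card_ord; lia.
move=> /injectivePn[i1 [i2 ne e]].
by rewrite (alternationX_eq0 ne) ?scaler0 //; exact: (congr1 val e).
Qed.

Lemma msym_linear_prod (w : 'S_N) r e :
  msym w (linear_prod k r)`_e = (linear_prod k (map w r))`_e.
Proof.
elim: r e => [|i r IHr] e; first by rewrite /linear_prod !big_nil coef1 rmorph_nat.
rewrite /= !coef_linear_prod_cons msymD IHr; congr (_ + _).
by case: e => [|e]; rewrite ?msym0 // msymM msymXi IHr.
Qed.

Lemma linear_prod_sym e : (linear_prod k (enum 'I_N))`_e \is symmetric.
Proof.
apply/issymP => w; rewrite msym_linear_prod; congr (_ `_ e).
rewrite (@linear_prod_perm _ _ (map w (enum 'I_N)) (enum 'I_N)) // uniq_perm ?enum_uniq ?(map_inj_uniq perm_inj) ?enum_uniq // => i.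
by rewrite mem_enum; apply/mapP; exists (w^-1%g i); rewrite ?mem_enum ?permKV.
Qed.

End Alternation.
Lemma coefM_ord (R : comNzRingType) (p r : {poly R}) m n q :
    (forall i, (m < i)%N -> p`_i = 0) -> (forall j, (n < j)%N -> r`_j = 0) ->
  (p * r)`_q = \sum_(i < m.+1) \sum_(j < n.+1 | (i + j == q)%N) p`_i * r`_j.
Proof.
have trunc (s : {poly R}) e : (forall i, (e < i)%N -> s`_i = 0) ->
    s = \sum_(i < e.+1) s`_i *: 'X^i.
  move=> hs; rewrite -poly_def; apply/polyP => i; rewrite coef_poly.
  by case: ltnP => // /hs.
move=> hp hr; rewrite {1}(trunc p m hp) {1}(trunc r n hr).
rewrite mulr_suml coef_sum; apply: eq_bigr => i _.
rewrite mulr_sumr coef_sum [RHS]big_mkcond /=; apply: eq_bigr => j _.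
rewrite -scalerAl -scalerAr scalerA -exprD coefZ coefXn eq_sym.
by case: ifP => _; rewrite ?mulr1 ?mulr0.
Qed.

Section Sharpness.
Variables (k : fieldType) (m n : nat).
Hypothesis mn : (m <= n)%N.
Local Notation kXY := {mpoly k[m.+1 + n.+1]}.
Local Notation xv := (@xvar k m n).
Local Notation yv := (@yvar k m n).
Local Notation f := (gen_f k m n).
Local Notation g := (gen_g k m n).
Local Notation J := (content (f * g)).
Local Notation N := (m + n)%N.
Local Notation S := {mpoly k[m + n]}.

Let rx : seq 'I_N := map (lshift n) (enum 'I_m).
Let ry : seq 'I_N := map (@rshift m n) (enum 'I_n).
Let Fx : {poly S} := linear_prod k rx.
Let Gy : {poly S} := linear_prod k ry.

Let mem_rx i : (i \in rx) = (i < m)%N.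
Proof.
apply/mapP/idP => [[j _ ->]|hi]; first exact: (valP j).
by exists (Ordinal hi); [rewrite mem_enum|apply: val_inj].
Qed.

Let mem_ry i : (i \in ry) = ~~ (i < m)%N.
Proof.
rewrite -leqNgt; apply/mapP/idP => [[j _ ->]|hi]; first exact: leq_addr.
have hj : (i - m < n)%N by have := ltn_ord i; lia.
by exists (Ordinal hj); [rewrite mem_enum|apply: val_inj; rewrite /= subnKC].
Qed.

Let uniq_rx : uniq rx.
Proof. by rewrite map_inj_uniq ?enum_uniq //; apply: lshift_inj. Qed.

Let uniq_ry : uniq ry.
Proof. by rewrite map_inj_uniq ?enum_uniq //; apply: rshift_inj. Qed.

Let FG : Fx * Gy = linear_prod k (enum 'I_N).
Proof.
rewrite -linear_prod_cat; apply: linear_prod_perm; apply: uniq_perm.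
- rewrite cat_uniq uniq_rx uniq_ry andbT; apply/hasPn => i.
  by rewrite /= mem_ry mem_rx.
- exact: enum_uniq.
- by move=> i; rewrite mem_cat mem_rx mem_ry mem_enum orbN.
Qed.

(* f becomes c (1 + s_1 t) ... (1 + s_m t) and g becomes                      *)
(* c' (1 + s_(m+1) t) ... (1 + s_N t): c and c' record the bidegree.          *)
Let point (v : 'I_(m.+1 + n.+1)) : {poly {poly S}} :=
  match split v with
  | inl i => (Fx`_i *: 'X)%:P
  | inr j => (Gy`_j)%:P *: 'X
  end.

Let ev := mmap (polyC \o polyC \o @mpolyC (m + n) k) point.

Let evM p q : ev (p * q) = ev p * ev q.
Proof. by rewrite /ev rmorphM. Qed.

Let ev_x i : ev (xv i) = (Fx`_i *: 'X)%:P.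
Proof. by rewrite /ev mmapX mmap1U /point (unsplitK (inl i)). Qed.

Let ev_y j : ev (yv j) = (Gy`_j)%:P *: 'X.
Proof. by rewrite /ev mmapX mmap1U /point (unsplitK (inr j)). Qed.

Let ev_h q : ev (hpoly k q) = ((Fx * Gy)`_q *: 'X)%:P * 'X.
Proof.
rewrite (coefM_ord (m := m) (n := n)); first last.
- by move=> j hj; apply: linear_prod_coef_gt; rewrite size_map size_enum_ord.
- by move=> i hi; apply: linear_prod_coef_gt; rewrite size_map size_enum_ord.
rewrite /hpoly /ev rmorph_sum scaler_suml (rmorph_sum polyC) mulr_suml.
apply: eq_bigr => i _; rewrite /= rmorph_sum scaler_suml (rmorph_sum polyC) mulr_suml.
apply: eq_bigr => j _; rewrite /= rmorphM /= -/ev ev_x ev_y.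
rewrite -[_%:P *: 'X]mul_polyC mulrA -rmorphM /=; congr (_%:P * _).
by rewrite -!mul_polyC rmorphM /= mulrAC.
Qed.

(** Bounds the degree in the variable [i] of the part of bidegree (a, b): a coefficient of [Fx] has
    degree at most 1 in each of the first m variables, one of [Gy] in each of the others. *)
Let D a b i := (count_mem i rx * a + count_mem i ry * b)%N.

Let D_add a b a' b' i : (D a b i + D a' b' i = D (a + a') (b + b') i)%N.
Proof. by rewrite /D; ring. Qed.

Let Fx_bounded i : deg_bounded (fun j => count_mem j rx) Fx`_i.
Proof. exact: linear_prod_deg_bounded. Qed.

Let Gy_bounded i : deg_bounded (fun j => count_mem j ry) Gy`_i.
Proof. exact: linear_prod_deg_bounded. Qed.

Let ev_deg_bounded p a b : deg_bounded (D a b) (ev p)`_b`_a.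
Proof.
elim/mpoly_subring_ind: p a b => [c|v|p q hp hq|p q hp hq] a b.
- rewrite /ev mmapC /= !coefC; case: b => [|b] /=; last first.
    by rewrite coef0; apply: deg_bounded0.
  rewrite coefC; case: a => [|a] /=; [exact: deg_boundedC|exact: deg_bounded0].
- rewrite -[v]splitK; case: (split v) => [i|j] /=.
    rewrite -/(xvar k n i) ev_x coefC; case: b => [|b] /=; last first.
      by rewrite coef0; apply: deg_bounded0.
    rewrite coefZ coefX; case: eqP => [->|_]; last first.
      by rewrite mulr0; apply: deg_bounded0.
    rewrite mulr1.
    apply: deg_boundedW (@Fx_bounded i) => i'.
    by rewrite /D muln1 leq_addr.
  rewrite -/(yvar k m j) ev_y coefZ coefX; case: eqP => [->|_]; last first.
    by rewrite mulr0 coef0; apply: deg_bounded0.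
  rewrite mulr1 coefC; case: a => [|a] /=; last exact: deg_bounded0.
  apply: deg_boundedW (@Gy_bounded j) => i'.
  by rewrite /D muln1 leq_addl.
- by rewrite /ev rmorphD /= !coefD; apply: deg_boundedD; [apply: hp|apply: hq].
- rewrite /ev rmorphM /= coefM coef_sum; apply: deg_bounded_sum => i _.
  rewrite coefM; apply: deg_bounded_sum => j _.
  apply: deg_boundedW (deg_boundedM (hp j i) (hq (a - j)%N (b - i)%N)) => i'.
  by rewrite D_add !subnKC // -ltnS.
Qed.

(** Chosen for two reasons. Times the m-th power of the product of the last n variables, it becomes
    the staircase 0, ..., N-1. Raising each exponent by m-1 stays below N-1: it gives at most 2m-2
    on the first m variables, where m <= n enters, and at most m+n-2 on the others. *)
Let rho : 'X_{1..N} := [multinom (if (i < m)%N then val i else i - m)%N | i < N].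

Let functional p := alternation ('X_[rho] * (ev p)`_m`_m).

Let functionalD p q : functional (p + q) = functional p + functional q.
Proof.
rewrite /functional /ev rmorphD /= !coefD mulrDr /alternation -big_split /=.
by apply: eq_bigr => w _; rewrite msymD mulrDr.
Qed.

(** [hpoly k q] contributes bidegree (1, 1) with a symmetric coefficient, which leaves the
    alternation; the remaining factor of bidegree (m-1, m-1) times [rho] has no room for N distinct
    exponents. *)
Let functional_J q p : functional (hpoly k q * p) = 0.
Proof.
(* For m = 0 a multiple of h_q has no part of bidegree (0, 0) at all. *)
have [m0|m_gt0] := posnP m.
  suff e : (ev (hpoly k q * p))`_m = 0 by rewrite /functional e coef0 mulr0 alternation0.
  by rewrite evM ev_h -mulrA coefCM coefXM (introT eqP m0) mulr0.
rewrite /functional.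
have -> : ((ev (hpoly k q * p))`_m)`_m = (Fx * Gy)`_q * (ev p)`_m.-1`_m.-1.
  rewrite evM ev_h -mulrA coefCM coefXM -scalerAl coefZ coefXM.
  by rewrite gtn_eqF.
rewrite mulrCA FG alternationM ?linear_prod_sym //.
rewrite (alternation_deg_bounded (D := fun i => rho i + D m.-1 m.-1 i)%N) ?mulr0 //.
- by rewrite addn_gt0 m_gt0.
- move=> i; rewrite mnmE /D !count_uniq_mem // mem_rx mem_ry.
  by have := ltn_ord i; case: (ltnP i m) => /= *; lia.
- have hr : deg_bounded rho 'X_[k, rho] by move=> mon /mem_msuppXP->.
  exact: deg_boundedM hr (@ev_deg_bounded p m.-1 m.-1).
Qed.

Let functional_xy : functional (xv ord0 ^+ m * yv ord_max ^+ m) != 0.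
Proof.
suff -> : functional (xv ord0 ^+ m * yv ord_max ^+ m) =
    alternation 'X_[[multinom val i | i < N]] by apply: alternation_vandermonde.
rewrite /functional; congr alternation.
have -> : (ev (xv ord0 ^+ m * yv ord_max ^+ m))`_m`_m = Gy`_n ^+ m.
  rewrite evM /ev !rmorphXn /= -/ev ev_x ev_y linear_prod_coef0 scale1r.
  rewrite exprZn -rmorphXn coefCM coefZ coefXn eqxx mulr1 -rmorphXn.
  by rewrite mulrC coefCM coefXn eqxx mulr1.
have -> : Gy`_n = \prod_(i <- ry) 'X_i.
  by rewrite -linear_prod_coef_size size_map size_enum_ord.
rewrite mprodXE mpolyXn -mpolyXD; congr mpolyX; apply/mnmP => i.
rewrite mnmDE mulmnE !mnmE mnm_sumE.
have -> : (\sum_(j <- ry) U_(j)%MM i = (i \in ry))%N.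
  rewrite -(count_uniq_mem _ uniq_ry) -sum1_count [RHS]big_mkcond /=.
  by apply: eq_bigr => j _; rewrite mnm1E; case: eqP.
by rewrite mem_ry; case: ltnP => hi; rewrite ?mul0n ?addn0 ?mul1n ?subnK.
Qed.

Lemma xy_power_notin_content d : (d <= m)%N ->
  xv ord0 ^+ d * yv ord_max ^+ d \notin J.
Proof.
move=> dm; apply/negP => hd.
have cl := ideal_gen_closed (mem (f * g : seq _)).
have : xv ord0 ^+ m * yv ord_max ^+ m \in J.
  suff -> : xv ord0 ^+ m * yv ord_max ^+ m =
      xv ord0 ^+ (m - d) * yv ord_max ^+ (m - d) * (xv ord0 ^+ d * yv ord_max ^+ d).
    exact: idealMl.
  by rewrite mulrACA -!exprD subnK.
move: functional_xy => /negP h0 h1; apply: h0.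
(* The kernel of [functional] need not be an ideal; the elements all of whose multiples lie in it
   form one, and it contains every h_q. *)
have {h1} : xv ord0 ^+ m * yv ord_max ^+ m \in
   (fun p => `[< forall p', functional (p * p') = 0 >]).
  move: h1; apply: content_fg_min.
    split; first by apply/asboolP => p'; rewrite mul0r /functional /ev raddf0 !coef0 mulr0 alternation0.
    move=> a u v /asboolP hu /asboolP hv; apply/asboolP => p'.
    by rewrite mulrDl functionalD hv addr0 -mulrA mulrCA hu.
  by move=> q; apply/asboolP => p'; apply: functional_J.
by move=> /asboolP/(_ 1); rewrite mulr1 => ->.
Qed.

End Sharpness.
(** * Chains of primes and algebraic independence *)

Section PrimeChains.
Variables (k : fieldType) (B : comNzRingType) (iota : {rmorphism k -> B}).

Definition prime_tower e (P : nat -> {pred B}) (a : nat -> B) :=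
  [/\ forall s, (s <= e)%N -> ideal_closed (P s),
      forall s, (s <= e)%N -> forall u v, u * v \in P s -> u \notin P s -> v \in P s,
      forall s, (s < e)%N -> {subset P s <= P s.+1},
      forall s, (s < e)%N -> a s \in P s.+1 /\ a s \notin P s
    & 1 \notin P e].

(* Cancel in P_s the lowest power of a_s, then reduce modulo P_(s+1), which   *)
(* contains a_s: only the exponents that are minimal at s survive.            *)
Lemma prime_tower_independent e P a (T : eqType) (r : seq T) (c : T -> k)
    (ex : T -> nat -> nat) :
    prime_tower e P a -> uniq r -> (forall t, t \in r -> c t != 0) ->
    {in r &, forall t u, (forall i, (i < e)%N -> ex t i = ex u i) -> t = u} ->
    \sum_(t <- r) iota (c t) * \prod_(0 <= i < e) a i ^+ ex t i \in P 0%N ->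
  r = [::].
Proof.
move=> [cl pr incl ha P1] ur hc hex hsum; case: (eqVneq r [::]) => // r0.
(* At [s = e] the surviving terms agree in all exponents, so a single one is left; its invertible
   coefficient would put 1 in [P e]. *)
suff: forall s, (s <= e)%N -> exists2 r' : seq T,
    [/\ subseq r' r, r' != [::] &
       {in r' &, forall t u i, (i < s)%N -> ex t i = ex u i}]
    & \sum_(t <- r') iota (c t) * \prod_(s <= i < e) a i ^+ ex t i \in P s.
  move=> /(_ e (leqnn e))[r' [sub r'0 agree]].
  case: r' sub r'0 agree => [//|t r'] sub _ agree.
  have tr u : u \in t :: r' -> u \in r by apply: mem_subseq.
  have r'nil : r' = [::].
    case: r' sub agree tr => [//|u r'] sub agree tr.
    have tu : t = u.
      by apply: hex; rewrite ?tr ?inE ?eqxx ?orbT // => i; apply: agree;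
        rewrite !inE eqxx ?orbT.
    by have := subseq_uniq sub ur; rewrite /= tu inE eqxx.
  rewrite r'nil big_seq1 big_geq // mulr1 => h.
  have := idealMl (cl e (leqnn e)) (iota (c t)^-1) h.
  by rewrite -rmorphM mulVf ?hc ?tr ?mem_head // rmorph1 (negPf P1).
elim=> [|s IHs] hs; first by exists r.
have [r' [sub r'0 agree] hP] := IHs (ltnW hs).
have hmin : exists d, has (fun t => ex t s == d) r'.
  by case: r' r'0 {sub agree hP} => [//|t r'] _; exists (ex t s); rewrite /= eqxx.
case: (ex_minnP hmin) => d /hasP[t0 t0r t0d] dmin.
pose F t := iota (c t) * (a s ^+ (ex t s - d) * \prod_(s.+1 <= i < e) a i ^+ ex t i).
have hF : \sum_(t <- r') F t \in P s.
  have cls := cl s (ltnW hs); have [_ as_] := ha s hs.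
  have asd : a s ^+ d \notin P s.
    elim: (d) => [|d' IHd].
      by rewrite expr0; apply: contra as_ => h; rewrite -[a s]mulr1; apply: idealMl.
    by apply/negP; rewrite exprS => /(pr s (ltnW hs))/(_ as_); rewrite (negPf IHd).
  apply: (pr s (ltnW hs) (a s ^+ d) _ _ asd).
  suff -> : a s ^+ d * \sum_(t <- r') F t =
    \sum_(t <- r') iota (c t) * \prod_(s <= i < e) a i ^+ ex t i by [].
  rewrite mulr_sumr !big_seq; apply: eq_bigr => t tr.
  rewrite big_ltn // /F mulrCA; congr (_ * _); rewrite mulrA -exprD subnKC //.
  by apply: dmin; apply/hasP; exists t.
exists [seq t <- r' | ex t s == d].
  split.
  - exact: subseq_trans (filter_subseq _ _) sub.
  - by rewrite -has_filter; apply/hasP; exists t0.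
  - move=> t u; rewrite !mem_filter => /andP[/eqP td tr] /andP[/eqP ud ur'] i.
    by rewrite ltnS leq_eqVlt => /predU1P[->|]; [rewrite td ud|apply: agree].
have clS := cl s.+1 hs.
have := incl s hs _ hF; rewrite (bigID (fun t => ex t s == d)) /=.
have h2 : \sum_(t <- r' | ex t s != d) F t \in P s.+1.
  rewrite big_seq_cond; apply: ideal_sum => // t /andP[tr td].
  rewrite /F mulrCA; apply: idealMr_closed => //.
  have : (d < ex t s)%N.
    by rewrite ltn_neqAle eq_sym td dmin //; apply/hasP; exists t.
  rewrite -subn_gt0; case: (ex t s - d)%N => // d' _; rewrite exprSr.
  by apply: idealMl => //; have [] := ha s hs.
move=> h1; have := idealB clS h1 h2; rewrite addrK big_filter.
rewrite (eq_bigr (fun t => iota (c t) * \prod_(s.+1 <= i < e) a i ^+ ex t i)) // => t /eqP td.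
by rewrite /F td subnn expr0 mul1r.
Qed.

End PrimeChains.

(** * Dimension bound from polynomial growth *)

Section DimensionBound.
Variables (k : fieldType) (B : comNzRingType) (iota : {rmorphism k -> B}) (N : nat).
Variable fam : forall D, {ffun 'I_N -> 'I_D.+1} -> B.

(** Level [D] of a filtration of B with (D+1)^N generators; the hypotheses below make it
    multiplicative and exhaustive, so that B has growth of degree at most N. *)
Definition spanned D z := exists c : {ffun 'I_N -> 'I_D.+1} -> k,
  z = \sum_t iota (c t) * fam t.

Hypothesis spanned1 : forall D, spanned D 1.
Hypothesis spannedM : forall D D' u v,
  spanned D u -> spanned D' v -> spanned (D + D') (u * v).
Hypothesis spanned_all : forall z, exists D, spanned D z.

Lemma spannedW D D' z : (D <= D')%N -> spanned D z -> spanned D' z.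
Proof.
by move=> le hz; rewrite -(subnKC le) -[z]mulr1; apply: spannedM.
Qed.

(* More than N elements a_i would have (D+1)^e > dim monomials with           *)
(* exponents at most D, hence a nontrivial linear relation between them.      *)
Lemma prime_tower_bound e (P : nat -> {pred B}) a : prime_tower e P a -> (e <= N)%N.
Proof.
move=> tower; rewrite leqNgt; apply/negP => Ne.
have [C hC] : exists C, forall i, (i < e)%N -> spanned C (a i).
  elim: (e) => [|e' [C hC]]; first by exists 0%N.
  have [C' hC'] := spanned_all (a e').
  exists (C + C')%N => i; rewrite ltnS leq_eqVlt => /predU1P[->|/hC].
    by apply: spannedW hC'; apply: leq_addl.
  by apply: spannedW; apply: leq_addr.
(* Monomials with exponents at most [D] lie in level [E], and (E+1)^N <= (e C + 1)^N (D+1)^N <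
   (D+1)^(N+1) by this choice of [D]. *)
pose D := ((e * C).+1 ^ N)%N; pose E := (e * (D * C))%N.
pose T := {ffun 'I_e -> 'I_D.+1}; pose ex (t : T) i := oapp (fun j => val (t j)) 0%N (insub i).
pose mono t := \prod_(0 <= i < e) a i ^+ ex t i.
have powC i d : (i < e)%N -> spanned (d * C) (a i ^+ d).
  move=> ie; elim: d => [|d IHd]; first by rewrite expr0; apply: spanned1.
  by rewrite exprS mulSn; apply: spannedM => //; apply: hC.
have monoE t : spanned E (mono t).
  suff: forall e', (e' <= e)%N ->
      spanned (e' * (D * C)) (\prod_(0 <= i < e') a i ^+ ex t i) by apply.
  elim=> [|e' IHe] he'; first by rewrite big_geq //; apply: spanned1.
  rewrite big_nat_recr //= mulSn addnC; apply: spannedM; first exact: IHe (ltnW he').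
  apply: spannedW (powC _ _ he'); rewrite leq_mul2r; apply/orP; right.
  by rewrite /ex; case: insubP => //= j _ _; rewrite -ltnS.
have [c hc] := choice monoE.
pose M : 'M[k]_(#|T|, #|{ffun 'I_N -> 'I_E.+1}|) :=
  \matrix_(i, j) c (enum_val i) (enum_val j).
have [v v0 vM] : exists2 v : 'rV_#|T|, v != 0 & v *m M = 0.
  have lt_dim : (#|{ffun 'I_N -> 'I_E.+1}| < #|T|)%N.
    rewrite !card_ffun !card_ord.
    apply: (@leq_trans (D.+1 ^ N.+1)); last exact: leq_pexp2l.
    rewrite expnS; apply: (@leq_ltn_trans ((e * C).+1 ^ N * D.+1 ^ N)%N).
      rewrite -expnMn; have : (E.+1 <= (e * C).+1 * D.+1)%N by rewrite /E; nia.
      by case: (N) => // N' h; rewrite leq_exp2r.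
    by rewrite ltn_pmul2r ?expn_gt0.
  have : kermx M != 0.
    rewrite -mxrank_eq0 mxrank_ker subn_eq0 -ltnNge.
    by apply: leq_ltn_trans lt_dim; apply: rank_leq_col.
  by case/rowV0Pn => v /sub_kermxP vM v0; exists v.
pose r := [seq t <- enum T | v 0 (enum_rank t) != 0].
suff r0 : r = [::].
  move/negP: v0; apply; apply/eqP/rowP => i; rewrite mxE.
  apply/eqP; have := in_nil (enum_val i); rewrite -r0 mem_filter mem_enum andbT enum_valK.
  by move=> /negbFE.
apply: (@prime_tower_independent k B iota e P a T r (fun t => v 0 (enum_rank t)) ex tower).
- by rewrite filter_uniq ?enum_uniq.
- by move=> t; rewrite mem_filter => /andP[].
- move=> t u _ _ tu; apply/ffunP => i; apply: val_inj.
  by have := tu i (ltn_ord i); rewrite /ex valK.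
suff -> : \sum_(t <- r) iota (v 0 (enum_rank t)) * \prod_(0 <= i < e) a i ^+ ex t i = 0.
  by case: tower => cl *; apply: (cl 0%N (leq0n e)).1.
rewrite big_filter big_mkcond big_enum /=.
transitivity (\sum_(t : T) \sum_u iota (v 0 (enum_rank t) * c t u) * fam u).
  apply: eq_bigr => t _; rewrite -/(mono t) {1}(hc t) mulr_sumr.
  case: eqP => [->|_] /=; first by rewrite big1 // => u _; rewrite mul0r rmorph0 mul0r.
  by apply: eq_bigr => u _; rewrite mulrA -rmorphM.
rewrite exchange_big big1 //= => u _; rewrite -mulr_suml -rmorph_sum.
have := congr1 (fun w : 'rV_ _ => w 0 (enum_rank u)) vM; rewrite !mxE.
rewrite (reindex_onto enum_rank enum_val) /=; last by move=> i _; apply: enum_valK.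
under eq_bigl => t do rewrite enum_rankK eqxx.
under eq_bigr => t _ do rewrite mxE !enum_rankK.
by move=> ->; rewrite rmorph0 mul0r.
Qed.

Lemma prime_chain_bound e (P : 'I_e.+1 -> prime_idealr B) : prime_chain P -> (e <= N)%N.
Proof.
move=> hP; pose Q s : {pred B} := P (inord s).
have lt_ord s : (s < e)%N -> ((inord s : 'I_e.+1) < (inord s.+1 : 'I_e.+1))%N.
  by move=> se; rewrite !inordK // ltnS ltnW.
have exa s : exists z, (s < e)%N -> z \in Q s.+1 /\ z \notin Q s.
  have [se|] := ltnP s e; last by exists 0.
  have [_ /existsNP[z /not_implyP[z1 /negP z2]]] := hP _ _ (lt_ord s se).
  by exists z.
have [a ha] := choice exa.
apply: (@prime_tower_bound e Q a); split => //.
- move=> s _; split; first exact: rpred0.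
  by move=> b u v hu hv; rewrite rpredD // idealMr.
- by move=> s _ u v; rewrite prime_idealrM => /orP[->|].
- by move=> s se; have [] := hP _ _ (lt_ord s se).
- by rewrite idealr1.
Qed.

End DimensionBound.
Section Kernels.
Variables (B : comNzRingType) (C : idomainType).

Lemma kernel_ideal_closed (phi : {rmorphism B -> C}) :
  ideal_closed (fun z => phi z == 0).
Proof.
split=> [|b u v]; rewrite !unfold_in ?rmorph0 // => /eqP hu /eqP hv.
by rewrite rmorphD rmorphM hu hv mulr0 addr0.
Qed.

Lemma kernel_prime (phi : {rmorphism B -> C}) :
  prime_idealr_closed (fun z => phi z == 0).
Proof. by move=> u v; rewrite !unfold_in rmorphM mulf_eq0. Qed.

Lemma kernel_tower e (phi : nat -> {rmorphism B -> C}) a :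
    (forall s z, phi s z = 0 -> phi s.+1 z = 0) ->
    (forall s, (s < e)%N -> phi s.+1 (a s) = 0 /\ phi s (a s) != 0) ->
  prime_tower e (fun s z => phi s z == 0) a.
Proof.
move=> incl ha; split=> [s _|s _ u v|s _ z|s /ha[h1 h2]|].
- exact: kernel_ideal_closed.
- by move=> /kernel_prime /orP[->|].
- by rewrite !unfold_in => /eqP/incl ->.
- by rewrite !unfold_in h1 h2.
- by rewrite unfold_in rmorph1 oner_eq0.
Qed.

End Kernels.

(** * A chain of coordinate subspaces and the independence of the h_q *)

Section CoordinateSubspaces.
Variables (k : fieldType) (N : nat).
Local Notation R := {mpoly k[N]}.
Implicit Types V : pred 'I_N.

Definition restriction V : R -> R :=
  mmap (@mpolyC N k) (fun v => if V v then 'X_v else 0).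

HB.instance Definition _ V := GRing.RMorphism.on (restriction V).

(* The variables outside V vanish and u = 'X records the total degree. *)
Definition graded_restriction V : R -> {poly R} :=
  mmap (polyC \o @mpolyC N k) (fun v => if V v then 'X_v *: 'X else 0).

HB.instance Definition _ V := GRing.RMorphism.on (graded_restriction V).

Lemma restrictionX V v : restriction V 'X_v = if V v then 'X_v else 0.
Proof. by rewrite /restriction mmapX mmap1U. Qed.

Lemma restrictionC V c : restriction V c%:MP = c%:MP.
Proof. by rewrite /restriction mmapC. Qed.

Lemma graded_restrictionX V v :
  graded_restriction V 'X_v = if V v then 'X_v *: 'X else 0.
Proof. by rewrite /graded_restriction mmapX mmap1U. Qed.

Lemma graded_restrictionC V c : graded_restriction V c%:MP = c%:MP%:P.
Proof. by rewrite /graded_restriction mmapC. Qed.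

(** Factoring the smaller restriction through the larger one makes the kernels grow along the
    chain. *)
Lemma graded_restriction_sub V V' p : (forall v, V' v -> V v) ->
  graded_restriction V' p = map_poly (restriction V') (graded_restriction V p).
Proof.
move=> VV'; elim/mpoly_subring_ind: p => [c|v|p q hp hq|p q hp hq].
- by rewrite !graded_restrictionC map_polyC /= restrictionC.
- rewrite !graded_restrictionX; case: ifP => [hv|hv].
    by rewrite VV' // map_polyZ /= map_polyX restrictionX hv.
  by case: ifP => _; rewrite ?rmorph0 // map_polyZ /= restrictionX hv scale0r.
- by rewrite !rmorphD /= hp hq.
- by rewrite !rmorphM /= hp hq.
Qed.

End CoordinateSubspaces.

Section HookChain.
Variables (k : fieldType) (m n : nat).
Local Notation kXY := {mpoly k[m.+1 + n.+1]}.
Local Notation xv := (@xvar k m n).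
Local Notation yv := (@yvar k m n).
Local Notation h := (@hpoly k m n).

(* The first m steps remove x_m, ..., x_1, the next n steps y_n, ..., y_1,    *)
(* and the last one x_0.                                                      *)
Definition hook (s : nat) : pred 'I_(m.+1 + n.+1) := fun v =>
  match split v with
  | inl i => (i <= m - s)%N && (s <= m + n)%N
  | inr j => (j <= n - (s - m))%N
  end.

Local Notation tau s := (graded_restriction (hook s)).

Lemma hook_sub s s' : (s <= s')%N -> forall v, hook s' v -> hook s v.
Proof. by move=> le v; rewrite /hook; case: (split v) => [i|j]; lia. Qed.

Definition in_hook s (i : 'I_m.+1) (j : 'I_n.+1) :=
  [&& (i <= m - s)%N, (s <= m + n)%N & (j <= n - (s - m))%N].

Lemma hook_xy s i j : tau s (xv i * yv j) =
  if in_hook s i j then (xv i * yv j) *: 'X^2 else 0.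
Proof.
rewrite rmorphM /= !graded_restrictionX /hook (unsplitK (inl i)) (unsplitK (inr j)).
rewrite /in_hook andbA; case: (_ && _) => /=; last by rewrite mul0r.
case: ifP => _; last by rewrite mulr0.
by rewrite -scalerAl -scalerAr scalerA.
Qed.

Lemma hook_hpoly s (q : 'I_(m + n).+1) : tau s (h q) =
  \sum_(i < m.+1) \sum_(j < n.+1 | (i + j == q)%N)
    (if in_hook s i j then (xv i * yv j) *: 'X^2 else 0).
Proof.
rewrite /hpoly rmorph_sum /=; apply: eq_bigr => i _; rewrite rmorph_sum /=.
by apply: eq_bigr => j _; apply: hook_xy.
Qed.

(** After s <= m+n steps the surviving x_i y_j have i+j at most m+n-s, with equality only at the
    corner (m-s, n-(s-m)), subtractions truncated; the next step removes this corner. So h_(m+n-s)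
    is a single monomial at step s and zero at step s+1. *)
Lemma hook_hpoly_eq0 s : (s <= m + n)%N -> tau s.+1 (h (inord (m + n - s))) = 0.
Proof.
move=> hs; rewrite hook_hpoly big1 // => i _; rewrite big1 // => j.
rewrite inordK ?ltnS ?leq_subr // => /eqP e.
have := ltn_ord i; have := ltn_ord j; rewrite /in_hook; case: ifP => //; lia.
Qed.

Lemma hook_hpoly_neq0 s : (s <= m + n)%N -> tau s (h (inord (m + n - s))) != 0.
Proof.
move=> hs; rewrite hook_hpoly.
have i0P : (m - s < m.+1)%N by rewrite ltnS leq_subr.
have j0P : (n - (s - m) < n.+1)%N by rewrite ltnS leq_subr.
rewrite (bigD1 (Ordinal i0P)) //= (bigD1 (Ordinal j0P)) /=; last first.
  by rewrite inordK ?ltnS ?leq_subr //; lia.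
rewrite [X in _ + X + _]big1 ?addr0 ?[X in _ + X]big1 ?addr0.
- rewrite /in_hook /= !leqnn hs /= -size_poly_gt0 size_scale ?size_polyXn //.
  by rewrite mulf_neq0 // /xvar /yvar -msupp_eq0 msuppX.
- move=> i; rewrite -val_eqE /= => ni; rewrite big1 // => j.
  rewrite inordK ?ltnS ?leq_subr // => /eqP e.
  have := ltn_ord i; have := ltn_ord j; rewrite /in_hook; case: ifP => //; lia.
- move=> j; rewrite -val_eqE /= inordK ?ltnS ?leq_subr // => /andP[/eqP e nj].
  have := ltn_ord j; rewrite /in_hook /=; case: ifP => //; lia.
Qed.

(** [prime_tower_independent] for the elements h_(m+n-s): the index is reversed since the chain
    kills the h_q from the top down. *)
Lemma hpoly_alg_independent : alg_independent h.
Proof.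
move=> p hp; pose P s : {pred kXY} := fun z => tau s z == 0.
pose a s := h (inord (m + n - s)).
pose ex (mon : 'X_{1..(m + n).+1}) i := mon (inord (m + n - i)).
suff /msuppnil0 : msupp p = [::] by [].
apply: (@prime_tower_independent k kXY (@mpolyC (m.+1 + n.+1) k)
   (m + n).+1 P a _ (msupp p) (fun mon => p@_mon) ex).
- apply: (@kernel_tower kXY {poly kXY} _ (fun s => tau s) a) => s /=.
    by move=> z hz; rewrite (graded_restriction_sub _ (hook_sub (leqnSn s))) hz rmorph0.
  by rewrite ltnS => hs; rewrite hook_hpoly_eq0 ?hook_hpoly_neq0.
- exact: msupp_uniq.
- by move=> mon; rewrite mcoeff_msupp.
- move=> t u _ _ tu; apply/mnmP => i.
  have im : (i <= m + n)%N := ltn_ord i.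
  by have := tu (m + n - i)%N (leq_subr _ _); rewrite /ex subKn // inord_val.
suff -> : \sum_(mon <- msupp p) (p@_mon)%:MP * \prod_(0 <= i < (m + n).+1) a i ^+ ex mon i = 0.
  exact: (kernel_ideal_closed _).1.
rewrite -[RHS]hp /mmap; apply: eq_bigr => mon _; rewrite -[in_alg _ _]/(_%:A).
rewrite -mul_mpolyC mulr1; congr (_ * _).
rewrite big_mkord /mmap1 (reindex_inj rev_ord_inj) /=; apply: eq_bigr => i _.
have im : (i <= m + n)%N := ltn_ord i.
by rewrite /a /ex subSS subKn // inord_val.
Qed.

End HookChain.
(** * The special fiber *)

Lemma sub_mcoeff0_irrelevant (k : fieldType) (N : nat) (p : {mpoly k[N]}) :
  p - (p@_0%MM)%:MP \in irrelevant_ideal (k := k) (N := N).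
Proof.
have cl : ideal_closed (irrelevant_ideal (k := k) (N := N)) by apply: ideal_gen_closed.
elim/mpoly_subring_ind: p => [c|i|p q hp hq|p q hp hq].
- by rewrite mcoeffC eqxx mulr1 subrr; apply: ideal0.
- by rewrite mcoeffX mnm1_eq0 mpolyC0 subr0; apply: mem_ideal_gen; apply: codom_f.
- by rewrite mcoeffD mpolyCD opprD addrACA; apply: idealD.
rewrite rmorphM mpolyCM.
suff -> : p * q - (p@_0%MM)%:MP * (q@_0%MM)%:MP =
   p * (q - (q@_0%MM)%:MP) + (q@_0%MM)%:MP * (p - (p@_0%MM)%:MP).
  by apply: idealD => //; apply: idealMl.
by ring.
Qed.

Lemma low_ideal_closed (B C : comNzRingType) (phi : {rmorphism B -> {poly C}}) d :
  ideal_closed (fun p => `[< forall e, (e < d)%N -> (phi p)`_e = 0 >]).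
Proof.
split=> [|a u v /asboolP hu /asboolP hv]; apply/asboolP => e ed.
  by rewrite rmorph0 coef0.
rewrite rmorphD rmorphM coefD /= hv // addr0 coefM big1 // => i _.
by rewrite hu ?mulr0 //; apply: leq_ltn_trans ed; apply: leq_subr.
Qed.

Section SpecialFiber.
Variables (k : fieldType) (m n : nat).
Local Notation kXY := {mpoly k[m.+1 + n.+1]}.
Local Notation letter := ('I_m.+1 * 'I_n.+1)%type.
Local Notation xv := (@xvar k m n).
Local Notation yv := (@yvar k m n).
Local Notation I := (ideal_mul (content (gen_f k m n)) (content (gen_g k m n))).
Local Notation irr := (irrelevant_ideal (k := k) (N := m.+1 + n.+1)).
Local Notation rees := (rees I).
Local Notation F := (special_fiber I irr).

Section Evaluation.
Variable (C : idomainType) (phi : {rmorphism kXY -> {poly C}}).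
Hypothesis phi_var : forall v, (phi 'X_v)`_0 = 0.

Lemma irrelevant_low p : p \in irr -> (phi p)`_0 = 0.
Proof.
move=> hp; have : p \in (fun p => `[< forall e, (e < 1)%N -> (phi p)`_e = 0 >]).
  move: p hp; apply: ideal_gen_min; first exact: low_ideal_closed.
  by move=> _ /codomP[v ->]; apply/asboolP => -[|//] _; apply: phi_var.
by move=> /asboolP; apply.
Qed.

Lemma word_prod_low w e : (e < size w * 2)%N -> (phi (word_prod k w))`_e = 0.
Proof.
rewrite /word_prod; elim: w e => [|l w IHw] // e /=; rewrite big_cons !rmorphM /= => he.
have low v (p : {poly C}) e' : (forall e'', (e'' < e')%N -> p`_e'' = 0) ->
    (phi 'X_v * p)`_e' = 0.
  move=> hp; rewrite coefM big1 // => -[[|i] hi] _; first by rewrite phi_var mul0r.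
  by rewrite hp ?mulr0 //=; lia.
rewrite -mulrA; apply: (low) => e1 h1; apply: (low) => e2 h2; apply: IHw; lia.
Qed.

Lemma I_exp_low d p e : p \in ideal_exp I d -> (e < d * 2)%N -> (phi p)`_e = 0.
Proof.
move=> hp; have /asboolP : p \in
    (fun p => `[< forall e, (e < d * 2)%N -> (phi p)`_e = 0 >]).
  move: p hp; apply: I_exp_min; first exact: low_ideal_closed.
  by move=> w <-; apply/asboolP => e'; apply: word_prod_low.
by apply.
Qed.

(* Elements of I^i have order at least 2 i at the origin, and R[It] / m R[It] *)
(* retains their forms of degree 2 i.                                         *)
Definition fiber_eval (p : rees) : {poly C} :=
  \poly_(i < size (rees_val p)) (phi (rees_val p)`_i)`_(i * 2).

Lemma coef_fiber_eval p i : (fiber_eval p)`_i = (phi (rees_val p)`_i)`_(i * 2).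
Proof.
by rewrite coef_poly; case: ltnP => // hi; rewrite [(rees_val p)`_i]nth_default // rmorph0 coef0.
Qed.

Lemma rees_coef (p : rees) i : (rees_val p)`_i \in ideal_exp I i.
Proof. by case: p => p /= /asboolP. Qed.

Lemma fiber_evalD : {morph fiber_eval : p q / p + q}.
Proof.
by move=> p q; apply/polyP => i; rewrite coefD !coef_fiber_eval /= coefD rmorphD coefD.
Qed.

Lemma fiber_eval1 : fiber_eval 1 = 1.
Proof.
apply/polyP => i; rewrite coef_fiber_eval /= !coef1.
by case: i => [|i]; rewrite ?rmorph1 ?coef1 ?rmorph0 ?coef0.
Qed.

(** Factors from I^j and I^(i-j) have orders at least 2j and 2(i-j), so only their lowest forms
    contribute in degree 2i. *)
Lemma fiber_evalM : {morph fiber_eval : p q / p * q}.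
Proof.
move=> p q; apply/polyP => i; rewrite coefM coef_fiber_eval /= coefM.
rewrite rmorph_sum coef_sum; apply: eq_bigr => j _.
rewrite !coef_fiber_eval rmorphM /= coefM.
have j2P : (j * 2 < (i * 2).+1)%N by have := ltn_ord j; lia.
rewrite (bigD1 (Ordinal j2P)) //= -mulnBl big1 ?addr0 // => e.
rewrite -val_eqE /= neq_ltn => /orP[lt|gt].
  by rewrite (I_exp_low (rees_coef p j)) ?mul0r.
rewrite (I_exp_low (rees_coef q (i - j))) ?mulr0 //.
have := ltn_ord e; have := ltn_ord j; lia.
Qed.

Lemma fiber_eval0 : fiber_eval 0 = 0.
Proof. by apply/polyP => i; rewrite coef_fiber_eval /= !coef0 rmorph0 coef0. Qed.

Lemma fiber_eval_eq0 z : z \in @fiber_ideal _ I irr -> fiber_eval z = 0.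
Proof.
move=> hz; apply/eqP; suff: z \in (fun z => fiber_eval z == 0) by [].
move: z hz; apply: ideal_gen_min.
  split=> [|b u v]; first by rewrite -topredE /= fiber_eval0.
  rewrite -!topredE /= => /eqP hu /eqP hv.
  by rewrite fiber_evalD fiber_evalM hu hv mulr0 addr0.
move=> _ /asboolP[a ha ->]; apply/eqP/polyP => i.
rewrite coef_fiber_eval coef0 /= coefZ coef1.
case: i => [|i]; last by rewrite mulr0 rmorph0 coef0.
by rewrite mulr1 mul0n irrelevant_low.
Qed.

End Evaluation.

End SpecialFiber.
Definition prime_idealr_of (A : comNzRingType) (P : {pred A}) (h1 : idealr_closed P)
    (h2 : prime_idealr_closed P) : prime_idealr A :=
  HB.pack P (isIdealr.Build A P h1) (isPrimeIdealrClosed.Build A P h2).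

Section AnalyticSpread.
Variables (k : fieldType) (m n : nat).
Local Notation kXY := {mpoly k[m.+1 + n.+1]}.
Local Notation letter := ('I_m.+1 * 'I_n.+1)%type.
Local Notation xv := (@xvar k m n).
Local Notation yv := (@yvar k m n).
Local Notation I := (ideal_mul (content (gen_f k m n)) (content (gen_g k m n))).
Local Notation irr := (irrelevant_ideal (k := k) (N := m.+1 + n.+1)).
Local Notation rees := (rees I).
Local Notation F := (special_fiber I irr).
Local Notation tau s := (graded_restriction (hook s)).

Definition fiber_pi (x : rees) : F := (\pi_F x)%qT.

Lemma fiber_piP (z : F) : exists x, z = fiber_pi x.
Proof. by exists (repr z); rewrite /fiber_pi reprK. Qed.

Lemma fiber_piD x y : fiber_pi (x + y) = fiber_pi x + fiber_pi y.
Proof. by rewrite /fiber_pi rmorphD. Qed.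

Lemma fiber_piM x y : fiber_pi (x * y) = fiber_pi x * fiber_pi y.
Proof. by rewrite /fiber_pi rmorphM. Qed.

Lemma fiber_pi1 : fiber_pi 1 = 1.
Proof. by rewrite /fiber_pi rmorph1. Qed.

Lemma fiber_pi_eq0 x : x \in @fiber_ideal _ I irr -> fiber_pi x = 0.
Proof.
move=> hx; have /eqP : (x == 0 %[mod F])%qT by rewrite -Quotient.idealrBE subr0.
by rewrite /fiber_pi => ->; rewrite -[RHS](rmorph0 (\pi_F)%qT).
Qed.

Section Kernel.
Variable (phi : {rmorphism kXY -> {poly kXY}}).
Hypothesis phi_var : forall v, (phi 'X_v)`_0 = 0.

Definition fiber_kernel : {pred F} := fun z => fiber_eval phi (repr z) == 0.

Lemma fiber_kernelE x : (fiber_pi x \in fiber_kernel) = (fiber_eval phi x == 0).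
Proof.
rewrite -topredE /= /fiber_kernel; congr (_ == _).
have : repr (fiber_pi x) - x \in @fiber_ideal _ I irr.
  by rewrite Quotient.idealrBE reprK.
move=> /(fiber_eval_eq0 phi_var) h.
by rewrite -[LHS](congr1 (fiber_eval phi) (subrK x _)) fiber_evalD h add0r.
Qed.

Lemma fiber_kernel_idealr : idealr_closed fiber_kernel.
Proof.
split.
- by rewrite -(fiber_pi_eq0 (ideal0 (ideal_gen_closed _))) fiber_kernelE fiber_eval0.
- by rewrite -fiber_pi1 fiber_kernelE fiber_eval1 oner_eq0.
move=> a u v; have [a' ->] := fiber_piP a; have [u' ->] := fiber_piP u.
have [v' ->] := fiber_piP v; rewrite -fiber_piM -fiber_piD !fiber_kernelE.
by rewrite fiber_evalD fiber_evalM // => /eqP-> /eqP->; rewrite mulr0 addr0.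
Qed.

Lemma fiber_kernel_prime : prime_idealr_closed fiber_kernel.
Proof.
move=> u v; have [u' ->] := fiber_piP u; have [v' ->] := fiber_piP v.
by rewrite -fiber_piM !fiber_kernelE fiber_evalM // mulf_eq0.
Qed.

End Kernel.

Lemma rees_gen_subproof (l : letter) : xyprod k l *: 'X \in rees_pred I.
Proof.
apply/asboolP => i; rewrite coefZ coefX; case: eqP => [->|_]; last first.
  by rewrite mulr0; apply: ideal0 (ideal_exp_closed _ _).
by rewrite mulr1 -[xyprod k l]mulr1; apply: ideal_mul_mem => //; apply: xyprod_mem.
Qed.

Definition rees_gen l : rees := Rees (rees_gen_subproof l).

Lemma hook_var s v : (tau s ('X_v : kXY))`_0 = 0.
Proof. by rewrite graded_restrictionX; case: ifP; rewrite ?coef0 // coefZ coefX mulr0. Qed.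

(** The primes are the kernels of [fiber_eval] along the hook. The generator of the Rees algebra
    given by the corner letter of step [s] is killed at every later step but not at [s]. *)
Lemma fiber_chain : exists P : 'I_(m + n + 1).+1 -> prime_idealr F, prime_chain P.
Proof.
exists (fun s => prime_idealr_of (fiber_kernel_idealr (hook_var s))
                    (fiber_kernel_prime (hook_var s))) => s s' ss'; split.
  move=> z; have [x ->] := fiber_piP z.
  move=> h; change (fiber_pi x \in fiber_kernel (tau s')).
  have {h} : fiber_pi x \in fiber_kernel (tau s) by exact: h.
  rewrite !fiber_kernelE //; try exact: hook_var.
  move=> /eqP/polyP h; apply/eqP/polyP => i; rewrite coef_fiber_eval coef0.
  have := h i; rewrite coef_fiber_eval coef0 => hi.
  have e := graded_restriction_sub (k := k) ((rees_val x)`_i) (hook_sub (ltnW ss')).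
  apply: etrans (congr1 (fun p : {poly _} => p`_(i * 2)) e) _.
  rewrite coef_map; exact: etrans (congr1 (restriction (hook s')) hi) (rmorph0 _).
move=> h.
have smn : (s <= m + n)%N by have := ltn_ord s'; lia.
have i0P : (m - s < m.+1)%N by rewrite ltnS leq_subr.
have j0P : (n - (s - m) < n.+1)%N by rewrite ltnS leq_subr.
pose l : letter := (Ordinal i0P, Ordinal j0P).
have {h} : fiber_pi (rees_gen l) \in fiber_kernel (tau s') ->
    fiber_pi (rees_gen l) \in fiber_kernel (tau s) by exact: h.
rewrite !fiber_kernelE; try exact: hook_var.
have ev s'' : fiber_eval (tau s'') (rees_gen l) =
   (if in_hook s'' l.1 l.2 then xyprod k l else 0) *: 'X.
  apply/polyP => i; rewrite coef_fiber_eval /= !coefZ !coefX.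
  case: eqP => [->|_]; last by rewrite !mulr0 rmorph0 coef0.
  rewrite !mulr1 hook_xy; case: ifP => _; last by rewrite coef0.
  by rewrite coefZ coefXn eqxx mulr1.
rewrite !ev; have -> : in_hook s l.1 l.2 by rewrite /in_hook /= !leqnn smn.
have /negPf-> : ~~ in_hook s' l.1 l.2 by rewrite /in_hook /=; lia.
rewrite scale0r eqxx => /(_ isT); rewrite scale_poly_eq0 polyX_eq0 orbF.
by rewrite mulf_eq0 -!msupp_eq0 !msuppX.
Qed.

End AnalyticSpread.

(** * Growth of the special fiber *)

Section FiberGenerators.
Variables (k : fieldType) (m n : nat).
Local Notation kXY := {mpoly k[m.+1 + n.+1]}.
Local Notation letter := ('I_m.+1 * 'I_n.+1)%type.
Local Notation I := (ideal_mul (content (gen_f k m n)) (content (gen_g k m n))).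
Local Notation irr := (irrelevant_ideal (k := k) (N := m.+1 + n.+1)).
Local Notation rees := (rees I).
Local Notation F := (special_fiber I irr).
Local Notation fiber_pi := (@fiber_pi k m n).

Definition fiber_scalar (c : k) : F := fiber_pi (c%:MP *: 1).

Lemma fiber_scalar_additive : additive fiber_scalar.
Proof. by move=> a b; rewrite /fiber_scalar mpolyCB scalerBl /fiber_pi rmorphB. Qed.

Lemma fiber_scalar_multiplicative : multiplicative fiber_scalar.
Proof.
split=> [a b|]; rewrite /fiber_scalar; last by rewrite scale1r fiber_pi1.
by rewrite -fiber_piM -scalerAl mul1r scalerA mpolyCM.
Qed.

HB.instance Definition _ := GRing.isAdditive.Build k F fiber_scalar fiber_scalar_additive.
HB.instance Definition _ :=
  GRing.isMultiplicative.Build k F fiber_scalar fiber_scalar_multiplicative.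

Definition rees_word (w : seq letter) : rees := \prod_(l <- w) rees_gen k l.

Definition word_mnm (w : seq letter) : 'X_{1..m.+1 + n.+1} :=
  (\sum_(l <- w) (U_(lshift n.+1 l.1) + U_(rshift m.+1 l.2)))%MM.

Lemma word_prod_mnm w : word_prod k w = 'X_[word_mnm w].
Proof.
rewrite /word_prod /word_mnm; elim: w => [|l w IHw]; first by rewrite !big_nil mpolyX0.
by rewrite !big_cons IHw mpolyXD mpolyXD.
Qed.

Lemma rees_val_word w : rees_val (rees_word w) = word_prod k w *: 'X^(size w).
Proof.
rewrite /rees_word /word_prod; elim: w => [|l w IHw].
  by rewrite !big_nil scale1r expr0.
rewrite !big_cons; change (xyprod k l *: 'X * rees_val (\prod_(l <- w) rees_gen k l) =
  xyprod k l * \prod_(e <- w) xyprod k e *: 'X^(size (l :: w))).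
by rewrite IHw -scalerAl -scalerAr scalerA -exprS.
Qed.

Lemma word_mnm_cons l w v : word_mnm (l :: w) v =
  ((lshift n.+1 l.1 == v) + (rshift m.+1 l.2 == v) + word_mnm w v)%N.
Proof. by rewrite /word_mnm big_cons !mnmDE !mnm1E. Qed.

Lemma word_mnm_le w v : (word_mnm w v <= size w)%N.
Proof.
elim: w => [|l w IHw]; first by rewrite /word_mnm big_nil mnm0E.
rewrite word_mnm_cons; apply: (leq_add _ IHw : _ <= 1 + size w)%N.
by case: eqP => [<-|_]; case: eqP => // /eqP; rewrite eq_rlshift.
Qed.

Lemma word_mnm_mdeg w : mdeg (word_mnm w) = (size w * 2)%N.
Proof.
elim: w => [|l w IHw]; first by rewrite /word_mnm big_nil mdeg0.
by rewrite /word_mnm big_cons !mdegD !mdeg1 -/(word_mnm w) IHw mulSn.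
Qed.

Lemma word_mnm_x w : (\sum_(i < m.+1) word_mnm w (lshift n.+1 i) = size w)%N.
Proof.
elim: w => [|l w IHw].
  by apply: big1 => i _; rewrite /word_mnm big_nil mnm0E.
under eq_bigr => i _ do rewrite word_mnm_cons eq_rlshift addn0 eq_lshift.
by rewrite big_split /= IHw (bigD1 l.1) //= eqxx big1 // => i; rewrite eq_sym => /negPf->.
Qed.

(** The excluded variable is y_n. The x-exponents add up to the length of the word, the total degree
    is twice the length, and this recovers the exponent of y_n. Hence m+n+1 coordinates suffice to
    index words. *)
Lemma word_mnm_inj w w' :
    (forall v : 'I_(m.+1 + n.+1), (v < m + n + 1)%N -> word_mnm w v = word_mnm w' v) ->
  size w = size w' /\ word_mnm w = word_mnm w'.
Proof.
move=> h; have hs : size w = size w'.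
  rewrite -!word_mnm_x; apply: eq_bigr => i _; apply: h => /=.
  by have := ltn_ord i; lia.
split=> //; apply/mnmP => v; have [hv|hv] := ltnP v (m + n + 1); first exact: h.
have := word_mnm_mdeg w; rewrite hs -word_mnm_mdeg !mdegE.
rewrite (bigD1 v) // [in X in _ = X](bigD1 v) //=.
suff -> : (\sum_(i | i != v) word_mnm w i = \sum_(i | i != v) word_mnm w' i)%N.
  exact: addIn.
apply: eq_bigr => i; rewrite -val_eqE /= => iv; apply: h.
by have := ltn_ord v; have := ltn_ord i; lia.
Qed.

Lemma rees_word_inj w w' :
    (forall v : 'I_(m.+1 + n.+1), (v < m + n + 1)%N -> word_mnm w v = word_mnm w' v) ->
  rees_word w = rees_word w'.
Proof.
move=> /word_mnm_inj[hs hw]; apply: val_inj.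
by rewrite /= !rees_val_word !word_prod_mnm hs hw.
Qed.

Let le_vars : (m + n + 1 <= m.+1 + n.+1)%N. Proof. by lia. Qed.

Definition word_key D (w : seq letter) : {ffun 'I_(m + n + 1) -> 'I_D.+1} :=
  [ffun v => inord (word_mnm w (widen_ord le_vars v))].

(** The class of any word of length at most [D] with the given key, the choice being immaterial by
    [rees_word_inj]; 0 for keys that no such word has. *)
Definition fiber_family D (t : {ffun 'I_(m + n + 1) -> 'I_D.+1}) : F :=
  if pselect (exists w, (size w <= D)%N /\ word_key D w = t) is left h
  then fiber_pi (rees_word (projT1 (cid h))) else 0.

Lemma fiber_family_key D w : (size w <= D)%N ->
  fiber_family (word_key D w) = fiber_pi (rees_word w).
Proof.
move=> hw; rewrite /fiber_family; case: pselect => [h|[]]; last by exists w.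
case: (cid h) => w' /= [hw' /ffunP key]; congr fiber_pi; apply: rees_word_inj => v hv.
have := key (Ordinal hv); rewrite !ffunE => /(congr1 val).
have -> : widen_ord le_vars (Ordinal hv) = v by apply: val_inj.
by rewrite /= !inordK // ltnS; apply: leq_trans (word_mnm_le _ _) _.
Qed.

Local Notation spanned := (spanned fiber_scalar fiber_family).

Lemma spanned0 D : spanned D 0.
Proof. by exists (fun _ => 0); rewrite big1 // => t _; rewrite rmorph0 mul0r. Qed.

Lemma spannedD D u v : spanned D u -> spanned D v -> spanned D (u + v).
Proof.
move=> [c ->] [d ->]; exists (fun t => c t + d t); rewrite -big_split /=.
by apply: eq_bigr => t _; rewrite rmorphD mulrDl.
Qed.

Lemma spannedZ D c u : spanned D u -> spanned D (fiber_scalar c * u).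
Proof.
move=> [d ->]; exists (fun t => c * d t); rewrite mulr_sumr.
by apply: eq_bigr => t _; rewrite rmorphM mulrA.
Qed.

Lemma spanned_word D w : (size w <= D)%N -> spanned D (fiber_pi (rees_word w)).
Proof.
move=> hw; exists (fun t => (t == word_key D w)%:R); rewrite (bigD1 (word_key D w)) //=.
rewrite eqxx rmorph1 mul1r fiber_family_key // big1 ?addr0 // => t /negPf->.
by rewrite rmorph0 mul0r.
Qed.

Lemma fiber_familyP D t : fiber_family t = 0 \/
  exists2 w, (size w <= D)%N & fiber_family (D := D) t = fiber_pi (rees_word w).
Proof.
rewrite /fiber_family; case: pselect => [h|_]; last by left.
by right; exists (projT1 (cid h)) => //; apply: (projT2 (cid h)).1.
Qed.

Lemma fiber_spanned1 D : spanned D 1.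
Proof.
have := @spanned_word D [::] isT.
by rewrite /rees_word big_nil fiber_pi1.
Qed.

Lemma spanned_sum D (T : Type) (r : seq T) (P : pred T) u :
  (forall t, P t -> spanned D (u t)) -> spanned D (\sum_(t <- r | P t) u t).
Proof. by move=> hu; apply: (big_ind (spanned D)) => //; [apply: spanned0|apply: spannedD]. Qed.

Lemma fiber_spannedM D D' u v : spanned D u -> spanned D' v -> spanned (D + D') (u * v).
Proof.
move=> [c ->] [d ->]; rewrite mulr_suml; apply: spanned_sum => t _.
rewrite mulr_sumr; apply: spanned_sum => t' _; rewrite mulrACA -rmorphM.
apply: spannedZ; case: (fiber_familyP t) => [->|[w hw ->]].
  by rewrite mul0r; apply: spanned0.
case: (fiber_familyP t') => [->|[w' hw' ->]]; first by rewrite mulr0; apply: spanned0.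
rewrite -fiber_piM -big_cat; apply: (@spanned_word _ (w ++ w')).
by rewrite size_cat leq_add.
Qed.

Lemma fiber_spanned_all z : exists D, spanned D z.
Proof.
have [x ->] := fiber_piP z.
have spannedW' D D' u : (D <= D')%N -> spanned D u -> spanned D' u.
  by apply: spannedW; [apply: fiber_spanned1|apply: fiber_spannedM].
have addP u v : (exists D, spanned D u) -> (exists D, spanned D v) ->
    exists D, spanned D (u + v).
  move=> [D hu] [D' hv]; exists (D + D')%N.
  by apply: spannedD; [apply: spannedW' hu|apply: spannedW' hv]; rewrite ?leq_addr ?leq_addl.
have monoP p i : p *: 'X^i \in rees_pred I -> p \in ideal_exp I i.
  by move=> /asboolP/(_ i); rewrite coefZ coefXn eqxx mulr1.
have monoP' p i : p \in ideal_exp I i -> p *: 'X^i \in rees_pred I.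
  move=> hp; apply/asboolP => j; rewrite coefZ coefXn.
  case: eqP => [->|_]; rewrite ?mulr1 ?mulr0 //.
  exact: ideal0 (ideal_exp_closed _ _).
have termP p i (h : p *: 'X^i \in rees_pred I) : exists D, spanned D (fiber_pi (Rees h)).
  have hp := monoP _ _ h; move: h.
  suff: p \in ideal_exp I i /\ forall h : p *: 'X^i \in rees_pred I,
      exists D, spanned D (fiber_pi (Rees h)) by case.
  (* Membership in I^i is carried along so that both summands of a combination can be wrapped by
     [Rees]. *)
  pose Q : {pred kXY} := fun p => `[< p \in ideal_exp I i /\
    forall h : p *: 'X^i \in rees_pred I, exists D, spanned D (fiber_pi (Rees h)) >].
  apply/asboolP; suff: p \in Q by [].
  move: p hp; apply: I_exp_min.
    split; first apply/asboolP.
      split=> [|h]; first exact: ideal0 (ideal_exp_closed _ _).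
      exists 0%N; suff -> : Rees h = 0 by rewrite /fiber_pi rmorph0; apply: spanned0.
      by apply: val_inj; rewrite /= scale0r.
    move=> a u v /asboolP[ui hu] /asboolP[vi hv]; apply/asboolP; split.
      by apply: (ideal_exp_closed I i).2.
    move=> h; have hu' := monoP' _ _ ui; have hv' := monoP' _ _ vi.
    (* The constant term of [a] acts as a scalar; the rest of [a] lies in [irr] and dies in the
       fiber. *)
    pose ac : kXY := (a@_0%MM)%:MP.
    have -> : Rees h = (ac *: 1) * Rees hu' + ((a - ac)%:A * Rees hu' + Rees hv').
      apply: val_inj => /=.
      change ((a * u + v) *: 'X^i = (ac *: 1) * (u *: 'X^i) +
         (((a - ac) *: 1) * (u *: 'X^i) + v *: 'X^i) :> {poly kXY}).
      by rewrite addrA -mulrDl -scalerDl [ac + _]addrC subrK -scalerAl mul1r scalerA scalerDl.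
    rewrite fiber_piD fiber_piM; apply: addP.
      by have [D hD] := hu hu'; exists D; apply: spannedZ.
    rewrite fiber_piD [fiber_pi (_ * _)]fiber_pi_eq0 ?add0r //.
    apply: idealMr_closed; first exact: ideal_gen_closed.
    apply: mem_ideal_gen; apply/asboolP; exists (a - ac) => //.
    exact: sub_mcoeff0_irrelevant.
  move=> w hw; apply/asboolP; split; first by have := word_prod_mem k w; rewrite hw.
  move=> h; exists i; suff -> : Rees h = rees_word w by apply: spanned_word; rewrite hw.
  by apply: val_inj; rewrite /= rees_val_word hw.
have coefP i : (rees_val x)`_i *: 'X^i \in rees_pred I.
  by apply: monoP'; apply: rees_coef.
have -> : x = \sum_(i < size (rees_val x)) Rees (coefP i).
  apply: val_inj; rewrite [RHS](big_morph val (fun _ _ => erefl) erefl) /=.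
  by rewrite -[LHS]coefK poly_def.
rewrite /fiber_pi rmorph_sum; apply: (big_ind (fun u => exists D, spanned D u)) => [||i _].
- by exists 0%N; apply: spanned0.
- exact: addP.
- exact: termP.
Qed.

Lemma analytic_spread_I : has_analytic_spread I (m + n + 1).
Proof.
split; first exact: fiber_chain.
move=> e P; apply: (prime_chain_bound (iota := fiber_scalar) (fam := fiber_family)).
- exact: fiber_spanned1.
- exact: fiber_spannedM.
- exact: fiber_spanned_all.
Qed.

End FiberGenerators.
(** * Noether normalization *)

Lemma prod_onth (R : comNzRingType) (T : Type) (F : T -> R) (w : seq T) d :
  (size w <= d)%N -> \prod_(i < d) oapp F 1 (onth w i) = \prod_(e <- w) F e.
Proof.
elim: w d => [|e w IHw] d hd; first by rewrite big_nil big1 // => i _; rewrite onth0n.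
by case: d hd => // d hd; rewrite big_cons big_ord_recl /= IHw.
Qed.

Section GeneratedSubalgebras.
Variables (k : fieldType) (S : comAlgType k).

Lemma gen_subalg_closed (G : {pred S}) : subalg_closed (gen_subalg G).
Proof.
split=> [|a u v /asboolP hu /asboolP hv|u v /asboolP hu /asboolP hv];
  apply/asboolP => A cA GA; have [A1 AL AM] := cA.
- exact: A1.
- by apply: AL; [apply: hu|apply: hv].
- by apply: AM; [apply: hu|apply: hv].
Qed.

Lemma mem_gen_subalg (G : {pred S}) x : x \in G -> x \in gen_subalg G.
Proof. by move=> Gx; apply/asboolP => A _; apply. Qed.

Lemma gen_subalg_min (G A : {pred S}) : subalg_closed A -> {subset G <= A} ->
  {subset gen_subalg G <= A}.
Proof. by move=> cA GA x /asboolP; apply. Qed.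

Section Closed.
Variable A : {pred S}.
Hypothesis cA : subalg_closed A.

Lemma subalg0 : 0 \in A.
Proof.
by have [A1 AL _] := cA; rewrite -(subrr 1) addrC -scaleN1r; apply: AL.
Qed.

Lemma subalgD u v : u \in A -> v \in A -> u + v \in A.
Proof. by move=> hu hv; have [_ AL _] := cA; rewrite -[u]scale1r; apply: AL. Qed.

Lemma subalgZ a u : u \in A -> a *: u \in A.
Proof. by move=> hu; have [_ AL _] := cA; have := AL a u 0 hu subalg0; rewrite addr0. Qed.

Lemma subalgN u : u \in A -> - u \in A.
Proof. by rewrite -scaleN1r; apply: subalgZ. Qed.

Lemma subalg_sum (T : Type) (r : seq T) (P : pred T) (F : T -> S) :
  (forall t, P t -> F t \in A) -> \sum_(t <- r | P t) F t \in A.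
Proof.
by move=> hF; apply: (big_ind (fun z => z \in A)) => //; [apply: subalg0|apply: subalgD].
Qed.

End Closed.
End GeneratedSubalgebras.

Section NoetherNormalization.
Variables (k : fieldType) (m n : nat).
Local Notation kXY := {mpoly k[m.+1 + n.+1]}.
Local Notation letter := ('I_m.+1 * 'I_n.+1)%type.
Local Notation h := (@hpoly k m n).
Local Notation A := (gen_subalg (mem (codom h)) : {pred kXY}).
Local Notation B := (gen_subalg (mem (codom (@xyprod k m n))) : {pred kXY}).

Let cA : subalg_closed A := gen_subalg_closed _.
Let cB : subalg_closed B := gen_subalg_closed _.

Lemma hpoly_subalg q : h q \in A.
Proof. by apply: mem_gen_subalg; apply: codom_f. Qed.

Lemma word_prod_subalg w : word_prod k w \in B.
Proof.
have [B1 _ BM] := cB; rewrite /word_prod; apply: (big_ind (fun z => z \in B)) => // e _.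
by apply: mem_gen_subalg; apply: codom_f.
Qed.

Lemma subalg_AB : {subset A <= B}.
Proof.
apply: gen_subalg_min => // _ /codomP[q ->]; apply: (subalg_sum cB) => i _.
apply: (subalg_sum cB) => j _; have := word_prod_subalg [:: (i, j)].
by rewrite /word_prod big_seq1.
Qed.

(** A finite type coding all words of length at most m, with [None] as padding; it indexes the
    module generators. *)
Let T := {ffun 'I_m -> option letter}.
Let b (t : T) : kXY := \prod_i oapp (@xyprod k m n) 1 (t i).

Let in_module (z : kXY) := exists2 c : T -> kXY,
  forall t, c t \in A & z = \sum_t c t * b t.

Let in_module0 : in_module 0.
Proof.
by exists (fun _ => 0) => [t|]; [apply: subalg0|rewrite big1 // => t _; rewrite mul0r].
Qed.

Let in_moduleM a z : a \in A -> in_module z -> in_module (a * z).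
Proof.
move=> aA [c cA' ->]; exists (fun t => a * c t) => [t|].
  by have [_ _ AM] := cA; apply: AM.
by rewrite mulr_sumr; apply: eq_bigr => t _; rewrite mulrA.
Qed.

Let in_moduleD u v : in_module u -> in_module v -> in_module (u + v).
Proof.
move=> [c cA' ->] [d dA ->]; exists (fun t => c t + d t) => [t|].
  exact: subalgD.
by rewrite -big_split; apply: eq_bigr => t _; rewrite mulrDl.
Qed.

Let in_moduleB u v : in_module u -> in_module v -> in_module (u - v).
Proof.
move=> hu hv; apply: in_moduleD => //; rewrite -mulN1r; apply: in_moduleM => //.
by apply: subalgN => //; have [] := cA.
Qed.

Let in_module_short w : (size w <= m)%N -> in_module (word_prod k w).
Proof.
move=> hw; pose t : T := [ffun i : 'I_m => onth w i].
exists (fun t' => (t' == t)%:R) => [t'|].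
  by case: eqP => _; [have [] := cA|apply: subalg0].
rewrite (bigD1 t) //= eqxx mul1r big1 ?addr0 => [|t' /negPf->]; last by rewrite mul0r.
rewrite /b /word_prod /t; under [RHS]eq_bigr => i _ do rewrite ffunE.
by rewrite (prod_onth (xyprod k (n:=n)) hw).
Qed.

(** Exchanging the first m+1 letters for h_q and m letters shortens the word by one, with a
    coefficient in k[h]. *)
Let in_module_word w : in_module (word_prod k w).
Proof.
elim: {w}(size w) {-2}w (leqnn (size w)) => [|d IHd] w hw.
  by apply: in_module_short; apply: leq_trans hw _.
have [wm|mw] := leqP (size w) m; first exact: in_module_short.
rewrite -(cat_take_drop m.+1 w) word_prod_cat.
apply: (@dedekind_mertens_words k m n
  (fun z => in_module (z * word_prod k (drop m.+1 w)))).
- by rewrite mul0r.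
- by move=> u v hu hv; rewrite mulrBl; apply: in_moduleB.
- move=> q w' sw'; rewrite -mulrA -word_prod_cat; apply: in_moduleM.
    exact: hpoly_subalg.
  apply: IHd; rewrite size_cat sw' size_drop; lia.
- by rewrite size_takel.
Qed.

Let in_module_all z : z \in B -> in_module z.
Proof.
pose Z : {pred kXY} := fun z => `[< exists s : seq (k * seq letter),
  z = \sum_(cw <- s) cw.1 *: word_prod k cw.2 >].
have cZ : subalg_closed Z.
  split=> [|a u v /asboolP[s ->] /asboolP[s' ->]|u v /asboolP[s ->] /asboolP[s' ->]];
    apply/asboolP.
  - by exists [:: (1, [::])]; rewrite big_seq1 scale1r /word_prod big_nil.
  - exists ([seq (a * cw.1, cw.2) | cw <- s] ++ s'); rewrite big_cat big_map scaler_sumr.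
    by congr (_ + _); apply: eq_bigr => cw _; rewrite scalerA.
  - exists [seq (c.1 * d.1, c.2 ++ d.2) | c <- s, d <- s'].
    rewrite big_allpairs_dep /= mulr_suml; apply: eq_bigr => c _.
    rewrite mulr_sumr; apply: eq_bigr => d _.
    by rewrite word_prod_cat -scalerAl -scalerAr scalerA.
move=> zB; have /asboolP[s ->] : z \in Z.
  move: z zB; apply: gen_subalg_min => // _ /codomP[e ->]; apply/asboolP.
  by exists [:: (1, [:: e])]; rewrite big_seq1 scale1r /word_prod big_seq1.
apply: (big_ind in_module) => // cw _.
rewrite -mul_mpolyC -[_%:MP]mulr1 mul_mpolyC; apply: in_moduleM => //.
by apply: subalgZ => //; have [] := cA.
Qed.

Lemma noether_normalization : is_noether_normalization A B.
Proof.
split; first by exists (m + n).+1, h; split=> //; apply: hpoly_alg_independent.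
- exact: subalg_AB.
exists #|T|, (fun i => b (enum_val i)); split=> [i|x /in_module_all[c cA' ->]].
  have [B1 _ BM] := cB; apply: (big_ind (fun z => z \in B)) => // j _.
  case: (enum_val i j) => [e|//] /=; apply: mem_gen_subalg; exact: codom_f.
exists (fun i => c (enum_val i)) => //.
by rewrite (reindex_onto enum_rank enum_val) => [|t _]; rewrite ?enum_valK //;
  apply: eq_big => [t|t _]; rewrite ?enum_rankK ?eqxx.
Qed.

End NoetherNormalization.
(** * Minimality of the reduction *)

Section LinearForms.
Variables (S : comNzRingType) (N : nat) (L : 'rV[S]_N -> Prop).
Hypotheses (L0 : L 0) (LM : forall a u v, L u -> L v -> L (a *: u + v)).

Let LZ a u : L u -> L (a *: u).
Proof. by move=> hu; rewrite -[_ *: _]addr0; apply: LM. Qed.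

Let LD u v : L u -> L v -> L (u + v).
Proof. by move=> hu hv; rewrite -[u]scale1r; apply: LM. Qed.

Let L_sum (P : pred 'I_N) F : (forall v, P v -> L (F v)) -> L (\sum_(v | P v) F v).
Proof. by move=> hF; apply: (big_ind L) => // *; apply: LD. Qed.

(* If every point lambda makes y^s lambda_i^d a value at lambda of a form in  *)
(* L, then L is everything up to powers of y: eliminate one coordinate w at a *)
(* time by evaluating at the point that kills the forms already obtained.     *)
Lemma linear_forms_full y s d :
    (forall (lam : 'rV[S]_N) i, exists2 l, L l &
       y ^+ s * lam 0 i ^+ d = \sum_j l 0 j * lam 0 j) ->
  exists e, forall i, L (y ^+ e *: delta_mx 0 i).
Proof.
move=> hL.
suff: forall r : seq 'I_N, uniq r -> exists e, forall v, v \in r -> exists l,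
    [/\ L l, l 0 v = y ^+ e & forall v', v' \in r -> v' != v -> l 0 v' = 0].
  move=> /(_ (enum 'I_N) (enum_uniq _))[e he]; exists e => i.
  have [l [Ll li l0]] := he i (mem_enum _ _).
  suff -> : y ^+ e *: delta_mx 0 i = l by [].
  apply/rowP => j; rewrite !mxE eqxx /=; have [->|ji] := eqVneq j i.
    by rewrite li mulr1.
  by rewrite mulr0 l0 ?mem_enum.
elim=> [|w r IHr] /=; first by exists 0%N.
move=> /andP[wr ur]; have [e he] := IHr ur.
have /choice[R hR] : forall v, exists l, v \in r ->
    [/\ L l, l 0 v = y ^+ e & forall v', v' \in r -> v' != v -> l 0 v' = 0].
  by move=> v; have [/he[l hl]|_] := boolP (v \in r); [exists l|exists 0].
pose lam := \row_j (if j == w then y ^+ e else if j \in r then - R j 0 w else 0).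
have [l Ll hl] := hL lam w.
(* Clearing the coordinates in [r] leaves at [w] the value of [l] at [lam], that is y^(s + e d),
   because [lam] kills each [R v]. *)
pose l' := y ^+ e *: l - \sum_(v | v \in r) l 0 v *: R v.
have Ll' : L l'.
  apply: LD; first exact: LZ.
  by rewrite -scaleN1r; apply: LZ; apply: L_sum => v /hR[]; auto.
have l'r v : v \in r -> l' 0 v = 0.
  move=> vr; rewrite !mxE summxE (bigD1 v) //= !mxE.
  have [_ -> _] := hR v vr; rewrite big1 ?addr0 => [|v' /andP[v'r v'v]].
    by rewrite mulrC subrr.
  by rewrite !mxE; have [_ _ ->] := hR v' v'r; rewrite ?mulr0 // eq_sym.
have l'w : l' 0 w = y ^+ (s + e * d).
  rewrite exprD exprM; have := hl; rewrite {1}mxE eqxx => ->.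
  rewrite (bigD1 w) //= [lam 0 w]mxE eqxx !mxE mulrC summxE; congr (_ + _).
  rewrite -sumrN big_mkcond [RHS]big_mkcond /=; apply: eq_bigr => v _.
  rewrite !mxE; case: (eqVneq v w) => [->|_]; first by rewrite (negPf wr).
  by case: ifP => _; rewrite ?mulr0 // mulrN.
clearbody l'; exists (e + (s + e * d))%N => v; rewrite inE => /predU1P[->|vr].
  exists (y ^+ e *: l'); split; first exact: LZ.
    by rewrite mxE l'w -exprD.
  by move=> v'; rewrite inE => /predU1P[->|/l'r h] ; rewrite ?eqxx // mxE h mulr0.
have [LR Rv R0] := hR v vr.
exists (y ^+ (s + e * d) *: R v - R v 0 w *: l'); split.
- by apply: LD; [apply: LZ|rewrite -scaleN1r; do 2!apply: LZ].
- by rewrite !mxE l'r // mulr0 subr0 Rv -exprD addnC.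
move=> v'; rewrite inE => /predU1P[-> _|v'r v'v].
  by rewrite !mxE l'w mulrC subrr.
by rewrite !mxE (l'r v') // (R0 v') // !mulr0 subr0.
Qed.

End LinearForms.

(** * Factoring polynomials over an extension field *)

Lemma root_extension (k : fieldType) (p : {poly k}) : (1 < size p)%N ->
  exists (E : fieldType) (iota : {rmorphism k -> E}) (x : E), root (map_poly iota p) x.
Proof.
move=> p1; have hq : exists d, `[< exists2 q : {poly k}, (1 < size q)%N && (q %| p) & size q = d >].
  by exists (size p); apply/asboolP; exists p; rewrite ?p1 ?dvdpp.
case: (ex_minnP hq) => d /asboolP[q /andP[q1 qp] qd] dmin.
have irr : irreducible_poly q.
  split=> // r r1 rq; rewrite -dvdp_size_eqp //.
  have q0 : q != 0 by rewrite -size_poly_gt0 ltnW.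
  have r0 : r != 0 by apply: contraNneq q0 => r0; rewrite -dvd0p -r0.
  rewrite eqn_leq dvdp_leq // qd dmin //; apply/asboolP; exists r => //.
  by rewrite (dvdp_trans rq qp) andbT ltn_neqAle eq_sym r1 size_poly_gt0.
have [E _ [x rx _]] := irredp_FAdjoin irr.
exists E, (in_alg E), x; have /dvdpP[c ->] := qp.
by rewrite rmorphM rootM rx orbT.
Qed.

(** While the degree is too large for g alone, a root is adjoined and its linear factor moved into
    f; this happens at most m times. *)
Lemma factor_extension (k : fieldType) m n (p : {poly k}) :
    p != 0 -> (size p <= (m + n).+1)%N ->
  exists (E : fieldType) (iota : {rmorphism k -> E}) (f g : {poly E}),
    [/\ map_poly iota p = f * g, f != 0, g != 0, (size f <= m.+1)%N & (size g <= n.+1)%N].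
Proof.
elim: m k p => [|m IHm] k p p0 sp.
  exists k, idfun, 1, p; rewrite mul1r oner_neq0 size_poly1 p0; split=> //.
  by rewrite map_poly_id.
have [sp'|sp'] := leqP (size p) (m + n).+1.
  have [E [iota [f [g [h1 h2 h3 h4 h5]]]]] := IHm k p p0 sp'.
  by exists E, iota, f, g; split=> //; apply: ltnW.
have [|E1 [iota1 [x /factor_theorem[p1 hp1]]]] := @root_extension k p.
  by apply: leq_trans sp'.
have p1p0 : p1 * ('X - x%:P) != 0 by rewrite -hp1 map_poly_eq0.
have p10 : p1 != 0 by apply: contraNneq p1p0 => ->; rewrite mul0r.
have sp1 : (size p1 <= (m + n).+1)%N.
  have : size (p1 * ('X - x%:P)) = size p by rewrite -hp1 size_map_poly.
  rewrite size_Mmonic ?monicXsubC // size_XsubC addn2 /= => hs.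
  by rewrite -ltnS hs.
have [E [iota [f [g [h1 h2 h3 h4 h5]]]]] := IHm E1 p1 p10 sp1.
exists E, (iota \o iota1), (f * ('X - (iota x)%:P)), g; split=> //.
- rewrite map_poly_comp hp1 rmorphM /= h1 rmorphB /= map_polyX map_polyC /=.
  by rewrite mulrAC.
- by rewrite mulf_neq0 // polyXsubC_eq0.
- by rewrite size_Mmonic ?monicXsubC // size_XsubC addn2.
Qed.
(* Applied with X generated by the x_i and u the index of y_j (or conversely): *)
(* where y_j is invertible, I is the ideal of the x_i, which has no proper    *)
(* reduction.                                                                 *)
Section VariablePowers.
Variables (k : fieldType) (N : nat) (V : pred 'I_N) (u : 'I_N).
Local Notation R := {mpoly k[N]}.
Variables (X K T : {pred R}) (r : nat).
Hypotheses (hX : ideal_closed X) (hK : ideal_closed K).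
Hypothesis X_var : forall v, V v -> 'X_v \in X.
Hypothesis X_min : forall Q : {pred R}, ideal_closed Q ->
  (forall v, V v -> 'X_v \in Q) -> {subset X <= Q}.
Hypotheses (KX : {subset K <= X}) (TX : {subset T <= ideal_exp X r}).
Hypotheses (Vu : ~~ V u) (uV : forall v, V v -> ('X_u * 'X_v) ^+ r.+1 \in ideal_mul K T).
Hypothesis uX : forall z, z \in ideal_exp X r.+1 -> 'X_u ^+ r.+1 * z \in K.

Section Evaluations.
Variables (rho : {rmorphism R -> R}) (eval : 'rV[R]_N -> {rmorphism R -> {poly R}}).
Hypothesis rhoC : forall c, rho c%:MP = c%:MP.
Hypothesis rho_var : forall v, V v -> rho 'X_v = 0.
Hypothesis rho_other : forall v, ~~ V v -> rho 'X_v = 'X_v.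
Hypothesis evalC : forall lam c, eval lam c%:MP = c%:MP%:P.
Hypothesis eval_var : forall lam v,
  eval lam 'X_v = if V v then lam 0 v *: 'X else ('X_v : R)%:P.

Let rhoK a : rho (rho a) = rho a.
Proof.
elim/mpoly_subring_ind: a => [c|v|p q hp hq|p q hp hq].
- by rewrite !rhoC.
- by have [hv|hv] := boolP (V v); [rewrite rho_var ?rmorph0|rewrite !rho_other].
- by rewrite !rmorphD hp hq.
- by rewrite !rmorphM hp hq.
Qed.

Let rho_sub a : a - rho a \in X.
Proof.
elim/mpoly_subring_ind: a => [c|v|p q hp hq|p q hp hq].
- by rewrite rhoC subrr; apply: ideal0.
- have [hv|hv] := boolP (V v); first by rewrite rho_var // subr0; apply: X_var.
  by rewrite rho_other // subrr; apply: ideal0.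
- by rewrite rmorphD opprD addrACA; apply: idealD.
suff -> : p * q - rho (p * q) = p * (q - rho q) + rho q * (p - rho p).
  by apply: idealD => //; apply: idealMl.
by rewrite rmorphM; ring.
Qed.

Let eval0 lam a : (eval lam a)`_0 = rho a.
Proof.
elim/mpoly_subring_ind: a => [c|v|p q hp hq|p q hp hq].
- by rewrite evalC coefC eqxx rhoC.
- rewrite eval_var; case: ifP => hv; last by rewrite coefC eqxx rho_other ?hv.
  by rewrite coefZ coefX mulr0 rho_var.
- by rewrite !rmorphD coefD hp hq.
- by rewrite !rmorphM coef0M hp hq.
Qed.

Let low_mul (C : comNzRingType) (p q : {poly C}) a b :
    (forall e, (e < a)%N -> p`_e = 0) -> (forall e, (e < b)%N -> q`_e = 0) ->
  (forall e, (e < a + b)%N -> (p * q)`_e = 0) /\ (p * q)`_(a + b) = p`_a * q`_b.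
Proof.
move=> hp hq; split=> [e he|].
  rewrite coefM big1 // => i _; have [ia|ai] := ltnP i a; first by rewrite hp ?mul0r.
  by rewrite hq ?mulr0 //; have := ltn_ord i; lia.
have aP : (a < (a + b).+1)%N by rewrite ltnS leq_addr.
rewrite coefM (bigD1 (Ordinal aP)) //= addKn big1 ?addr0 // => i.
rewrite -val_eqE /= neq_ltn => /orP[lt|gt]; first by rewrite hp ?mul0r.
by rewrite hq ?mulr0 //; have := ltn_ord i; lia.
Qed.

Let eval_X lam d z e : z \in ideal_exp X d -> (e < d)%N -> (eval lam z)`_e = 0.
Proof.
elim: d z e => // d IHd z e hz he.
have /asboolP : z \in (fun p => `[< forall e, (e < d.+1)%N -> (eval lam p)`_e = 0 >]).
  move: z hz; apply: ideal_mul_min; first exact: low_ideal_closed.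
  move=> a b aX bX; apply/asboolP => e' he'; rewrite rmorphM.
  apply: (low_mul (a := 1) (b := d) _ _).1; last by rewrite add1n.
    move=> [|//] _; rewrite eval0.
    have : a \in (fun p => rho p == 0).
      move: a aX; apply: X_min; first exact: kernel_ideal_closed.
      by move=> v hv; rewrite -topredE /= rho_var.
    by move=> /eqP.
  by move=> e'' h''; apply: IHd.
by apply.
Qed.

(** The linear parts of elements of K modulo X^2, with coefficients restricted by [rho] to the
    subspace where the variables in [V] vanish. *)
Let L (l : 'rV[R]_N) := exists2 kap, kap \in K &
  kap - \sum_(v | V v) rho (l 0 v) * 'X_v \in ideal_exp X 2.

Let X2_closed : ideal_closed (ideal_exp X 2) := ideal_exp_closed _ _.

Let L0 : L 0.
Proof.
exists 0; first exact: ideal0.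
rewrite big1 ?subr0; first exact: ideal0.
by move=> v _; rewrite mxE rmorph0 mul0r.
Qed.

Let LM a l l' : L l -> L l' -> L (a *: l + l').
Proof.
move=> [kap hk h] [kap' hk' h']; exists (rho a * kap + kap').
  by apply: idealD => //; apply: idealMl.
suff -> : rho a * kap + kap' - \sum_(v | V v) rho ((a *: l + l') 0 v) * 'X_v =
   rho a * (kap - \sum_(v | V v) rho (l 0 v) * 'X_v) +
     (kap' - \sum_(v | V v) rho (l' 0 v) * 'X_v).
  by apply: idealD => //; apply: idealMl.
under eq_bigr => v _ do rewrite !mxE rmorphD rmorphM mulrDl -mulrA.
by rewrite big_split /= -mulr_sumr; ring.
Qed.

Let K_form kap : kap \in K -> exists2 a : 'rV[R]_N,
  forall v, ~~ V v -> a 0 v = 0 & kap = \sum_(v | V v) a 0 v * 'X_v.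
Proof.
move=> /KX hk; apply/asboolP; suff: kap \in (fun kap => `[< exists2 a : 'rV[R]_N,
  forall v, ~~ V v -> a 0 v = 0 & kap = \sum_(v | V v) a 0 v * 'X_v >]) by [].
move: kap hk; apply: X_min.
  split; first apply/asboolP.
    exists 0 => [v _|]; first by rewrite mxE.
    by rewrite big1 // => v _; rewrite mxE mul0r.
  move=> b p q /asboolP[a a0 ->] /asboolP[a' a0' ->]; apply/asboolP.
  exists (b *: a + a') => [v hv|]; first by rewrite !mxE a0 // a0' // mulr0 addr0.
  rewrite mulr_sumr -big_split /=; apply: eq_bigr => v _.
  by rewrite !mxE mulrDl mulrA.
move=> v hv; apply/asboolP; exists (delta_mx 0 v) => [v' hv'|].
  by rewrite mxE eqxx /=; case: eqP hv' => // ->; rewrite hv.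
rewrite (bigD1 v) //= mxE !eqxx mul1r big1 ?addr0 // => v' /andP[_ v'v].
by rewrite mxE eqxx (negPf v'v) mul0r.
Qed.

Let K_eval lam kap : kap \in K -> (eval lam kap)`_0 = 0 /\
  exists2 l, L l & (eval lam kap)`_1 = \sum_j l 0 j * lam 0 j.
Proof.
move=> hk; have [a a0 ka] := K_form hk; split.
  rewrite eval0 ka rmorph_sum big1 // => v hv.
  by rewrite rmorphM rho_var ?mulr0.
exists (\row_v rho (a 0 v)).
  exists kap => //; rewrite {1}ka -sumrB; apply: ideal_sum => // v hv.
  rewrite mxE rhoK -mulrBl -[2%N]/(1 + 1)%N; apply: ideal_expM.
    by rewrite -[_ - _]mulr1; apply: ideal_mul_mem.
  by rewrite -['X_v]mulr1; apply: ideal_mul_mem => //; apply: X_var.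
rewrite {1}ka rmorph_sum coef_sum big_mkcond /=; apply: eq_bigr => v _.
rewrite mxE rmorphM /= eval_var; case: ifP => hv.
  by rewrite hv -mul_polyC mulrCA coefCM coefMX eval0 mulrC.
by rewrite a0 ?hv // rmorph0 mul0r.
Qed.

(** Along [eval lam] elements of K have order at least 1 and those of T order at least r, so in
    degree r+1 only the product of leading coefficients remains, a multiple of the value at [lam] of
    a form in [L]. *)
Let KT_eval lam z : z \in ideal_mul K T ->
  exists2 l, L l & (eval lam z)`_r.+1 = \sum_j l 0 j * lam 0 j.
Proof.
pose Q : {pred R} := fun z => `[< (forall e, (e < r.+1)%N -> (eval lam z)`_e = 0) /\
  exists2 l, L l & (eval lam z)`_r.+1 = \sum_j l 0 j * lam 0 j >].
move=> hz; suff /asboolP[] : z \in Q by [].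
move: z hz; apply: ideal_mul_min.
  split; first apply/asboolP.
    split=> [e _|]; first by rewrite rmorph0 coef0.
    exists 0 => //; rewrite rmorph0 coef0 big1 // => j _.
    by rewrite mxE mul0r.
  move=> a p q /asboolP[p1 [l Ll hl]] /asboolP[q1 [l' Ll' hl']]; apply/asboolP.
  have [ap1 ap2] := @low_mul _ (eval lam a) (eval lam p) 0 r.+1 (fun e h => ltac:(by [])) p1.
  rewrite rmorphD rmorphM; split=> [e he|].
    by rewrite coefD ap1 // q1 // addr0.
  exists ((eval lam a)`_0 *: l + l'); first exact: LM.
  rewrite coefD ap2 hl hl' mulr_sumr -big_split /=; apply: eq_bigr => j _.
  by rewrite !mxE mulrDl mulrA.
move=> a b /(K_eval lam)[a0 [l Ll hl]] /TX bX; apply/asboolP.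
have [ab1 ab2] := @low_mul _ (eval lam a) (eval lam b) 1 r
  (fun e => if e is 0 then fun _ => a0 else fun h => ltac:(by [])) (fun e => eval_X lam bX).
rewrite rmorphM -add1n; split=> //.
exists ((eval lam b)`_r *: l); first by rewrite -[_ *: _]addr0; apply: LM.
rewrite ab2 hl mulrC mulr_sumr; apply: eq_bigr => j _.
by rewrite mxE mulrA.
Qed.

Lemma variable_power_linear_subproof : exists e, forall v, V v ->
  exists2 kap, kap \in K & kap - 'X_u ^+ e * 'X_v \in ideal_exp X 2.
Proof.
have [|e he] := @linear_forms_full _ _ L L0 LM 'X_u r.+1 r.+1.
  (* Coordinates outside [V] do not enter [L], so a multiple of [delta_mx 0 i] belongs to it with
     witness 0. *)
  move=> lam i; have [hi|hi] := boolP (V i); last first.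
    exists (('X_u ^+ r.+1 * lam 0 i ^+ r) *: delta_mx 0 i).
      exists 0; first exact: ideal0.
      rewrite big1 ?subr0 => [|v hv]; first exact: ideal0.
      rewrite !mxE eqxx /=; case: eqP => [e|_]; first by rewrite e (negPf hi) in hv.
      by rewrite mulr0 rmorph0 mul0r.
    rewrite (bigD1 i) //= big1 ?addr0 => [|j ji].
      by rewrite !mxE !eqxx mulr1 -mulrA -exprSr.
    by rewrite !mxE (negPf ji) andbF mulr0 mul0r.
  have [l Ll hl] := KT_eval lam (uV hi); exists l => //; rewrite -hl.
  rewrite rmorphXn rmorphM /= !eval_var hi (negPf Vu) mul_polyC scalerA exprZn coefZ.
  by rewrite coefXn eqxx mulr1 exprMn.
exists e => v hv; have [kap hk h] := he v; exists kap => //.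
rewrite (bigD1 v) //= big1 ?addr0 in h.
  by rewrite !mxE !eqxx mulr1 rmorphXn /= rho_other in h.
by move=> v' /andP[_ v'v]; rewrite !mxE (negPf v'v) andbF mulr0 rmorph0 mul0r.
Qed.

End Evaluations.

Lemma variable_power_linear : exists e, forall v, V v ->
  exists2 kap, kap \in K & kap - 'X_u ^+ e * 'X_v \in ideal_exp X 2.
Proof.
pose pt (lam : 'rV[R]_N) v := if V v then lam 0 v *: 'X else ('X_v : R)%:P.
apply: (@variable_power_linear_subproof (restriction (predC V))
  (fun lam => mmap (polyC \o @mpolyC N k) (pt lam))).
- by move=> c; apply: restrictionC.
- by move=> v hv; rewrite /= restrictionX /= hv.
- by move=> v hv; rewrite /= restrictionX /= hv.
- by move=> lam c; rewrite /= mmapC.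
- by move=> lam v; rewrite /= mmapX mmap1U.
Qed.

(** A Nakayama iteration: powers of X_u push each X_v into K + X^2, then into K + X^(r+1), and
    X_u^(r+1) carries X^(r+1) into K. *)
Lemma variable_power_mem : exists e, forall v, V v -> 'X_u ^+ e * 'X_v \in K.
Proof.
have [e2 he2] := variable_power_linear.
pose KpX s : {pred R} := fun z => `[< exists2 kap, kap \in K & z - kap \in ideal_exp X s >].
have KpX_closed s : ideal_closed (KpX s).
  have cs := ideal_exp_closed X s.
  split; first by apply/asboolP; exists 0; [apply: ideal0|rewrite subr0; apply: ideal0].
  move=> a p q /asboolP[kap hk h] /asboolP[kap' hk' h']; apply/asboolP.
  exists (a * kap + kap'); first by apply: idealD => //; apply: idealMl.
  suff -> : a * p + q - (a * kap + kap') = a * (p - kap) + (q - kap').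
    by apply: idealD => //; apply: idealMl.
  by ring.
have KpX_K s z : z \in K -> z \in KpX s.
  move=> hz; apply/asboolP; exists z => //; rewrite subrr.
  exact: ideal0 (ideal_exp_closed _ _).
have KpX_X s z : z \in ideal_exp X s -> z \in KpX s.
  move=> hz; apply/asboolP; exists 0; first exact: ideal0.
  by rewrite subr0.
have e2X z : z \in X -> 'X_u ^+ e2 * z \in KpX 2.
  move=> hz; rewrite mulrC; suff: z \in (fun z => z * 'X_u ^+ e2 \in KpX 2) by [].
  move: z hz; apply: X_min; first exact: ideal_closed_comp.
  move=> v hv; have [kap hk h] := he2 v hv; rewrite unfold_in mulrC.
  apply/asboolP; exists kap => //; rewrite -opprB.
  exact: idealN (ideal_exp_closed _ _) _ h.
have step s z : z \in ideal_exp X s.+1 -> 'X_u ^+ e2 * z \in KpX s.+2.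
  move=> hz; rewrite mulrC; suff: z \in (fun z => z * 'X_u ^+ e2 \in KpX s.+2) by [].
  move: z hz; apply: ideal_mul_min; first exact: ideal_closed_comp.
  move=> a b aX bX; rewrite unfold_in mulrC mulrA.
  have /asboolP[kap hk h] := e2X a aX; apply/asboolP; exists (kap * b).
    exact: idealMr_closed.
  by rewrite -mulrBl -[s.+2]/(2 + s)%N; apply: ideal_expM.
have all_s s : exists e, forall v, V v -> 'X_u ^+ e * 'X_v \in KpX s.+1.
  elim: s => [|s [e he]].
    exists 0%N => v hv; rewrite expr0 mul1r; apply: KpX_X.
    by rewrite -['X_v]mulr1; apply: ideal_mul_mem => //; apply: X_var.
  exists (e2 + e)%N => v hv; rewrite exprD -mulrA.
  have /asboolP[kap hk h] := he v hv.
  rewrite -(subrK kap ('X_u ^+ e * 'X_v)) mulrDr; apply: (idealD (KpX_closed _)).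
    exact: step.
  by apply: KpX_K; apply: idealMl.
have [e he] := all_s r; exists (r.+1 + e)%N => v hv; rewrite exprD -mulrA.
have /asboolP[kap hk h] := he v hv.
rewrite -(subrK kap ('X_u ^+ e * 'X_v)) mulrDr; apply: idealD => //.
  exact: uX.
exact: idealMl.
Qed.

End VariablePowers.

(** * Reductions inside J at the origin *)

Section Minimality.
Variables (k : fieldType) (m n : nat).
Local Notation kXY := {mpoly k[m.+1 + n.+1]}.
Local Notation xv := (@xvar k m n).
Local Notation yv := (@yvar k m n).
Local Notation h := (@hpoly k m n).
Local Notation f := (gen_f k m n).
Local Notation g := (gen_g k m n).
Local Notation I := (ideal_mul (content f) (content g)).
Local Notation J := (content (f * g)).
Local Notation irr := (irrelevant_ideal (k := k) (N := m.+1 + n.+1)).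

Lemma content_fg_form z : z \in J -> exists a : 'I_(m + n).+1 -> kXY, z = \sum_q a q * h q.
Proof.
move=> hz; apply/asboolP; suff: z \in (fun z => `[< exists a : 'I_(m + n).+1 -> kXY,
  z = \sum_q a q * h q >]) by [].
move: z hz; apply: content_fg_min.
  split; first by apply/asboolP; exists (fun _ => 0); rewrite big1 // => q _; rewrite mul0r.
  move=> b u v /asboolP[a ->] /asboolP[a' ->]; apply/asboolP.
  exists (fun q => b * a q + a' q); rewrite mulr_sumr -big_split /=.
  by apply: eq_bigr => q _; rewrite mulrDl mulrA.
move=> q; apply/asboolP; exists (fun q' => (q' == q)%:R); rewrite (bigD1 q) //= eqxx mul1r.
by rewrite big1 ?addr0 // => q' /negPf->; rewrite mul0r.
Qed.

Lemma irr_closed : ideal_closed irr. Proof. exact: ideal_gen_closed. Qed.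

Section Reduction.
Variables (K : {pred kXY}) (r : nat).
Hypotheses (hK : ideal_closed K) (KJ : {subset K <= J}).
Hypothesis hr : ideal_exp I r.+1 =i ideal_mul K (ideal_exp I r).

Let J_closed : ideal_closed J := ideal_gen_closed _.

(* If K and m J do not generate J, some nonzero lam in k^(m+n+1) kills the    *)
(* degree 2 forms of K. Over an extension of k the polynomial lam(t) is a     *)
(* product f0 g0, and along the arc (u f0, u g0) elements of K have order at  *)
(* least 3, whereas I has order 2: so I^(r+1) = K I^r is impossible.          *)
Section Arc.
Variables (E : fieldType) (iota : {rmorphism k -> E}) (phi : {rmorphism kXY -> {poly E}}).
Variables (f0 g0 : {poly E}) (lam : 'rV[k]_(m + n).+1).
Hypothesis phiC : forall c, phi c%:MP = (iota c)%:P.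
Hypothesis phi_x : forall i, phi (xv i) = f0`_i *: 'X.
Hypothesis phi_y : forall j, phi (yv j) = g0`_j *: 'X.
Hypotheses (f0_neq0 : f0 != 0) (g0_neq0 : g0 != 0).
Hypotheses (size_f0 : (size f0 <= m.+1)%N) (size_g0 : (size g0 <= n.+1)%N).
Hypothesis fg_lam : forall q : 'I_(m + n).+1, (f0 * g0)`_q = iota (lam 0 q).
Hypothesis lam_kill : forall c : 'rV[k]_(m + n).+1,
  (exists2 kap, kap \in K & \sum_q c 0 q *: h q - kap \in ideal_mul irr J) ->
  \sum_q c 0 q * lam 0 q = 0.

Let phi_var v : (phi 'X_v)`_0 = 0.
Proof.
rewrite -[v]splitK; case: (split v) => [i|j] /=.
  by rewrite -/(xvar k n i) phi_x coefZ coefX mulr0.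
by rewrite -/(yvar k m j) phi_y coefZ coefX mulr0.
Qed.

Let phi_coef0 a : (phi a)`_0 = iota a@_0%MM.
Proof.
rewrite -[in LHS](subrK (a@_0%MM)%:MP a) rmorphD coefD phiC coefC eqxx.
by rewrite (irrelevant_low phi_var) ?add0r //; apply: sub_mcoeff0_irrelevant.
Qed.

Let phi_h q : phi (h q) = iota (lam 0 q) *: 'X^2.
Proof.
rewrite -fg_lam (coefM_ord (m := m) (n := n)); first last.
- by move=> j nj; apply: nth_default; apply: leq_trans size_g0 _.
- by move=> i mi; apply: nth_default; apply: leq_trans size_f0 _.
rewrite /hpoly rmorph_sum scaler_suml; apply: eq_bigr => i _.
rewrite rmorph_sum scaler_suml; apply: eq_bigr => j _ /=.
by rewrite rmorphM /= phi_x phi_y -scalerAl -scalerAr scalerA.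
Qed.

(** The coefficient of u^2 is the pairing of [lam] with the constant terms of the coefficients of
    [kap] in the h_q; modulo [irr] J these constants already represent [kap], so [lam_kill]
    applies. *)
Let phi_K kap e : kap \in K -> (e < 3)%N -> (phi kap)`_e = 0.
Proof.
move=> hk he; have [a ka] := content_fg_form (KJ hk).
have -> : phi kap = (\sum_q phi (a q) * (iota (lam 0 q))%:P) * 'X^2.
  rewrite ka rmorph_sum mulr_suml; apply: eq_bigr => q _.
  by rewrite rmorphM /= phi_h -mulrA mul_polyC.
rewrite coefMXn; case: ltnP => // e2.
have -> : (e - 2 = 0)%N by lia.
rewrite coef_sum.
under eq_bigr => q _ do rewrite coefMC phi_coef0 -rmorphM.
rewrite -rmorph_sum; suff -> : \sum_q (a q)@_0%MM * lam 0 q = 0 by rewrite rmorph0.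
transitivity (\sum_q (\row_q0 (a q0)@_0%MM) 0 q * lam 0 q).
  by apply: eq_bigr => q _; rewrite mxE.
apply: lam_kill; exists kap => //; under eq_bigr => q _ do rewrite mxE.
rewrite ka -sumrB; apply: ideal_sum.
  exact: ideal_mul_closed.
move=> q _; rewrite -mul_mpolyC -mulrBl; apply: ideal_mul_mem.
  by rewrite -opprB; apply: idealN (irr_closed) _ _; apply: sub_mcoeff0_irrelevant.
exact: hpoly_content.
Qed.

Let phi_KI z e : z \in ideal_mul K (ideal_exp I r) -> (e <= r.+1 * 2)%N -> (phi z)`_e = 0.
Proof.
move=> hz he; have /asboolP : z \in
    (fun p => `[< forall e, (e < (r.+1 * 2).+1)%N -> (phi p)`_e = 0 >]).
  move: z hz; apply: ideal_mul_min; first exact: low_ideal_closed.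
  move=> a b aK bI; apply/asboolP => e' he'; rewrite rmorphM coefM big1 // => i _.
  have [i3|i3] := ltnP i 3; first by rewrite phi_K ?mul0r.
  rewrite (I_exp_low phi_var bI) ?mulr0 //; have := ltn_ord i; lia.
by apply; rewrite ltnS.
Qed.

Lemma arc_contradiction : False.
Proof.
have lead (p : {poly E}) d : p != 0 -> (size p <= d.+1)%N -> exists i : 'I_d.+1, p`_i != 0.
  move=> p0 sp; have hi : ((size p).-1 < d.+1)%N.
    by apply: leq_trans sp; rewrite prednK // size_poly_gt0.
  by exists (Ordinal hi); rewrite /= -lead_coefE lead_coef_eq0.
have [i fi] := lead f0 m f0_neq0 size_f0; have [j gj] := lead g0 n g0_neq0 size_g0.
have : (xv i * yv j) ^+ r.+1 \in ideal_mul K (ideal_exp I r).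
  rewrite -hr; have := word_prod_mem k (nseq r.+1 (i, j)); rewrite size_nseq.
  by rewrite /word_prod big_nseq -Monoid.iteropE.
move=> /phi_KI/(_ (leqnn _)); rewrite rmorphXn rmorphM /= phi_x phi_y.
rewrite -scalerAl -scalerAr scalerA exprZn -expr2 -exprM mulnC coefZ coefXn eqxx mulr1.
by move/eqP; rewrite expf_eq0 mulf_eq0 (negPf fi) (negPf gj) andbF.
Qed.

End Arc.

Let mod_mJ z := exists2 kap, kap \in K & z - kap \in ideal_mul irr J.

(** Duality over k: a proper subspace [L] of k^(m+n+1) would be annihilated by a nonzero [lam],
    which the arc excludes. [linear_forms_full] with y = 1 turns this into fullness of [L]. *)
Lemma hpoly_mod_mJ q : exists2 kap, kap \in K & h q - kap \in ideal_mul irr J.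
Proof.
have mJ_closed : ideal_closed (ideal_mul irr J) by apply: ideal_mul_closed.
pose L (c : 'rV[k]_(m + n).+1) := mod_mJ (\sum_q c 0 q *: h q).
have LM a u v : L u -> L v -> L (a *: u + v).
  move=> [kap hk hu] [kap' hk' hv]; exists (a%:MP * kap + kap').
    by apply: idealD => //; apply: idealMl.
  suff -> : \sum_q (a *: u + v) 0 q *: h q - (a%:MP * kap + kap') =
      a%:MP * (\sum_q u 0 q *: h q - kap) + (\sum_q v 0 q *: h q - kap').
    by apply: idealD => //; apply: idealMl.
  under eq_bigr => q' _ do rewrite !mxE scalerDl -scalerA.
  by rewrite big_split /= -scaler_sumr -mul_mpolyC; ring.
have L0 : L 0.
  exists 0; first exact: ideal0.
  by rewrite big1 ?subr0; [apply: ideal0|move=> q' _; rewrite mxE scale0r].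
have [|e he] := @linear_forms_full _ _ L L0 LM 1 0 1.
  move=> lam i; rewrite expr0 mul1r expr1.
  have [->|lam0] := eqVneq lam 0.
    by exists 0 => //; rewrite mxE big1 // => j _; rewrite mxE mul0r.
  apply/exists2P; apply: contrapT => hno.
  have kill c : L c -> \sum_q c 0 q * lam 0 q = 0.
    move=> Lc; apply/eqP; apply/negPn/negP => s0; apply: hno.
    exists ((lam 0 i / \sum_q c 0 q * lam 0 q) *: c); split.
      by rewrite -[_ *: _]addr0; apply: LM.
    under eq_bigr => q' _ do rewrite mxE -mulrA.
    by rewrite -mulr_sumr divfK.
  pose p := \poly_(q < (m + n).+1) lam 0 (inord q).
  have p0 : p != 0.
    apply: contraNneq lam0 => p0; apply/eqP/rowP => q'; rewrite mxE.
    by have := coef_poly (m + n).+1 (fun q => lam 0 (inord q)) q';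
      rewrite -/p p0 coef0 ltn_ord inord_val.
  have [E [iota [f0 [g0 [pfg f0n g0n sf sg]]]]] := factor_extension p0 (size_poly _ _).
  pose pt (v : 'I_(m.+1 + n.+1)) : {poly E} :=
    match split v with inl i => f0`_i *: 'X | inr j => g0`_j *: 'X end.
  apply: (@arc_contradiction E iota (mmap (polyC \o iota) pt) f0 g0 lam) => //=.
  - by move=> c; rewrite mmapC.
  - by move=> i'; rewrite mmapX mmap1U /pt (unsplitK (inl i')).
  - by move=> j'; rewrite mmapX mmap1U /pt (unsplitK (inr j')).
  - by move=> q'; rewrite -pfg coef_map /= coef_poly ltn_ord inord_val.
have := he q; rewrite expr1n scale1r => -[kap hk].
rewrite (bigD1 q) //= mxE !eqxx scale1r big1 ?addr0; first by exists kap.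
by move=> q' /negPf q'q; rewrite mxE q'q andbF scale0r.
Qed.

End Reduction.
End Minimality.

(** * From the local comparisons to K = J *)

Section IdealPowers.
Variable R : comNzRingType.
Implicit Types A B : {pred R}.

Lemma ideal_exp_sub A B d : {subset A <= B} -> {subset ideal_exp A d <= ideal_exp B d}.
Proof.
move=> AB; elim: d => [|d IHd] //=; apply: ideal_mul_min.
  exact: ideal_mul_closed.
by move=> a b aA bA; apply: ideal_mul_mem; [apply: AB|apply: IHd].
Qed.

Lemma ideal_exp_mem A a d : a \in A -> a ^+ d \in ideal_exp A d.
Proof.
by move=> aA; elim: d => [|d IHd] //; rewrite exprS; apply: ideal_mul_mem.
Qed.

Lemma ideal_mul_subl A B : ideal_closed A -> {subset ideal_mul A B <= A}.
Proof. by move=> hA; apply: ideal_mul_min => // a b aA _; apply: idealMr_closed. Qed.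

Lemma ideal_mul_subr A B : ideal_closed B -> {subset ideal_mul A B <= B}.
Proof. by move=> hB; apply: ideal_mul_min => // a b _ bB; apply: idealMl. Qed.

Lemma ideal_expMl A B a d z : a \in A -> z \in ideal_exp B d ->
  a ^+ d * z \in ideal_exp (ideal_mul A B) d.
Proof.
move=> aA; elim: d z => [|d IHd] z // hz; rewrite mulrC.
suff: z \in (fun z => z * a ^+ d.+1 \in ideal_exp (ideal_mul A B) d.+1) by [].
move: z hz; apply: ideal_mul_min; first exact: ideal_closed_comp (ideal_exp_closed _ _).
move=> b c bB cB; rewrite unfold_in mulrC exprS mulrACA.
by apply: ideal_mul_mem; [apply: ideal_mul_mem|apply: IHd].
Qed.

Lemma ideal_expMr A B b d z : b \in B -> z \in ideal_exp A d ->
  b ^+ d * z \in ideal_exp (ideal_mul A B) d.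
Proof.
move=> bB; elim: d z => [|d IHd] z // hz; rewrite mulrC.
suff: z \in (fun z => z * b ^+ d.+1 \in ideal_exp (ideal_mul A B) d.+1) by [].
move: z hz; apply: ideal_mul_min; first exact: ideal_closed_comp (ideal_exp_closed _ _).
move=> a c aA cA; rewrite unfold_in mulrC exprS mulrACA [b * a]mulrC.
by apply: ideal_mul_mem; [apply: ideal_mul_mem|apply: IHd].
Qed.

End IdealPowers.

(** Pigeonhole: a monomial of degree above N E has an exponent at least E. *)
Lemma irr_exp_min (k : fieldType) (N E s : nat) (A : {pred {mpoly k[N]}}) :
    ideal_closed A -> (forall v, 'X_v ^+ E \in A) -> (N * E < s)%N ->
  {subset ideal_exp (irrelevant_ideal (k := k) (N := N)) s <= A}.
Proof.
move=> hA XA Es z hz.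
pose M d : {pred {mpoly k[N]}} := fun p => `[< forall mon, (mdeg mon < d)%N -> p@_mon = 0 >].
have M_closed d : ideal_closed (M d).
  split; first by apply/asboolP => mon _; rewrite mcoeff0.
  move=> a u v /asboolP hu /asboolP hv; apply/asboolP => mon hmon.
  rewrite mcoeffD hv // addr0; apply: memN_msupp_eq0; apply/negP => /msuppM_le.
  move=> /allpairsP[[m1 m2] /= [_ h2 e]]; move: h2; rewrite mcoeff_msupp hu ?eqxx //.
  by apply: leq_ltn_trans hmon; rewrite e mdegD leq_addl.
have /asboolP zM : z \in M s.
  move: {Es} s z hz; elim=> [|d IHd] z hz; first by apply/asboolP.
  move: z hz; apply: ideal_mul_min => // a b airr bd.
  suff: a \in (fun a => a * b \in M d.+1) by [].
  move: a airr; apply: ideal_gen_min; first exact: ideal_closed_comp.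
  move=> _ /codomP[v ->]; apply/asboolP => mon hmon.
  apply: memN_msupp_eq0; apply/negP => /msuppM_le.
  move=> /allpairsP[[m1 m2] /= [/mem_msuppXP <- h2 e]]; move: h2.
  have /asboolP bM := IHd b bd; rewrite mcoeff_msupp bM ?eqxx //.
  by move: hmon; rewrite e mdegD mdeg1 ltnS add1n.
rewrite [z]mpolyE big_seq; apply: ideal_sum => // mon; rewrite mcoeff_msupp => hmon.
have [v Ev] : exists v, (E <= mon v)%N.
  apply: contrapT => /forallNP hno; move/eqP: hmon; apply; apply: zM.
  apply: leq_ltn_trans Es; rewrite mdegE -[N in (N * E)%N]card_ord -sum_nat_const.
  by apply: leq_sum => v _; apply: ltnW; rewrite ltnNge; apply/negP/hno.
rewrite -mul_mpolyC; apply: idealMl => //.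
have -> : 'X_[mon] = 'X_[mon - U_(v) *+ E] * 'X_v ^+ E :> {mpoly k[N]}.
  rewrite mpolyXn -mpolyXD submK //; apply/mnm_lepP => i; rewrite mulmnE mnm1E.
  by case: eqP => [<-|_]; rewrite ?mul1n ?mul0n.
exact: idealMl.
Qed.

Section MinimalReduction.
Variables (k : fieldType) (m n : nat).
Local Notation kXY := {mpoly k[m.+1 + n.+1]}.
Local Notation xv := (@xvar k m n).
Local Notation yv := (@yvar k m n).
Local Notation h := (@hpoly k m n).
Local Notation f := (gen_f k m n).
Local Notation g := (gen_g k m n).
Local Notation I := (ideal_mul (content f) (content g)).
Local Notation J := (content (f * g)).
Local Notation irr := (irrelevant_ideal (k := k) (N := m.+1 + n.+1)).

Variables (K : {pred kXY}) (r : nat).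
Hypotheses (hK : ideal_closed K) (KJ : {subset K <= J}).
Hypothesis hr : ideal_exp I r.+1 =i ideal_mul K (ideal_exp I r).

Let I_exp_K z : z \in ideal_exp I r.+1 -> z \in K.
Proof. by rewrite hr; apply: ideal_mul_subl. Qed.

Let J_f : {subset J <= content f}.
Proof. by move=> z /J_sub_I; apply: ideal_mul_subl; apply: ideal_gen_closed. Qed.

Let J_g : {subset J <= content g}.
Proof. by move=> z /J_sub_I; apply: ideal_mul_subr; apply: ideal_gen_closed. Qed.

Let y_power j : exists e, forall i, yv j ^+ e * xv i \in K.
Proof.
pose V (v : 'I_(m.+1 + n.+1)) := if split v is inl _ then true else false.
have Vx v : V v -> exists i, v = lshift n.+1 i.
  rewrite /V -{2}[v]splitK; case: (split v) => // i _; by exists i.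
have [|||||||||e he] := @variable_power_mem k _ V (rshift m.+1 j) (content f) K
  (ideal_exp I r) r.
- exact: ideal_gen_closed.
- exact: hK.
- by move=> v /Vx[i ->]; apply: xvar_content.
- move=> Q hQ QV; apply: content_f_min => // i; apply: QV.
  by rewrite /V (unsplitK (inl i)).
- by move=> z /KJ/J_f.
- by apply: ideal_exp_sub; apply: ideal_mul_subl; apply: ideal_gen_closed.
- by rewrite /V (unsplitK (inr j)).
- move=> v /Vx[i ->]; rewrite -hr exprMn; apply: ideal_expMr.
    exact: yvar_content.
  by apply: ideal_exp_mem; apply: xvar_content.
- by move=> z hz; apply: I_exp_K; apply: ideal_expMr => //; apply: yvar_content.
by exists e => i; apply: he; rewrite /V (unsplitK (inl i)).
Qed.

Let x_power i : exists e, forall j, xv i ^+ e * yv j \in K.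
Proof.
pose V (v : 'I_(m.+1 + n.+1)) := if split v is inr _ then true else false.
have Vy v : V v -> exists j, v = rshift m.+1 j.
  rewrite /V -{2}[v]splitK; case: (split v) => // j _; by exists j.
have [|||||||||e he] := @variable_power_mem k _ V (lshift n.+1 i) (content g) K
  (ideal_exp I r) r.
- exact: ideal_gen_closed.
- exact: hK.
- by move=> v /Vy[j ->]; apply: yvar_content.
- move=> Q hQ QV; apply: content_g_min => // j; apply: QV.
  by rewrite /V (unsplitK (inr j)).
- by move=> z /KJ/J_g.
- by apply: ideal_exp_sub; apply: ideal_mul_subr; apply: ideal_gen_closed.
- by rewrite /V (unsplitK (inl i)).
- move=> v /Vy[j ->]; rewrite -hr exprMn; apply: ideal_expMl.
    exact: xvar_content.
  by apply: ideal_exp_mem; apply: yvar_content.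
- by move=> z hz; apply: I_exp_K; apply: ideal_expMl => //; apply: xvar_content.
by exists e => j; apply: he; rewrite /V (unsplitK (inr j)).
Qed.

(** J lies in both c(f) and c(g), so [y_power] and [x_power] show that J/K is killed by a power of
    every variable, that is, supported at the origin. *)
Let var_power : exists E, forall v b, b \in J -> 'X_v ^+ E * b \in K.
Proof.
have one v : exists e, forall b, b \in J -> 'X_v ^+ e * b \in K.
  rewrite -[v]splitK; case: (split v) => [i|j] /=.
    have [e he] := x_power i; exists e => b /J_g bg; rewrite mulrC.
    suff: b \in (fun b => b * xv i ^+ e \in K) by [].
    move: b bg; apply: content_g_min; first exact: ideal_closed_comp.
    by move=> j; rewrite unfold_in mulrC.
  have [e he] := y_power j; exists e => b /J_f bf; rewrite mulrC.
  suff: b \in (fun b => b * yv j ^+ e \in K) by [].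
  move: b bf; apply: content_f_min; first exact: ideal_closed_comp.
  by move=> i; rewrite unfold_in mulrC.
have [e he] := choice one; exists (\sum_v e v)%N => v b bJ.
rewrite (bigD1 v) //= exprD mulrAC; apply: idealMr_closed => //; exact: he.
Qed.

(* No Nakayama lemma is available since R is not local: hpoly_mod_mJ settles  *)
(* the origin only, and var_power makes a power of m multiply J into K.       *)
Lemma J_sub_reduction : {subset J <= K}.
Proof.
(* Large enough that a monomial of degree [s] is divisible by the E-th power of some variable. *)
have [E hE] := var_power; pose s := ((m.+1 + n.+1) * E).+1.
have K_colon z : z \in ideal_mul (ideal_exp irr s) J -> z \in K.
  apply: ideal_mul_min => // a b airr bJ.
  have: a \in (fun a => `[< forall b, b \in J -> a * b \in K >]).
    move: a airr; apply: (irr_exp_min (E := E)) => //.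
      split; first by apply/asboolP => c _; rewrite mul0r; apply: ideal0.
      move=> d u v /asboolP hu /asboolP hv; apply/asboolP => c cJ.
      by rewrite mulrDl -mulrA; apply: idealD; [|apply: idealMl|]; auto.
    by move=> v; apply/asboolP => c; apply: hE.
  by move=> /asboolP; apply.
pose KJs d : {pred kXY} := fun z =>
  `[< exists2 kap, kap \in K & z - kap \in ideal_mul (ideal_exp irr d) J >].
have KJs_closed d : ideal_closed (KJs d).
  have cl := ideal_mul_closed (ideal_exp irr d) J.
  split; first by apply/asboolP; exists 0; [apply: ideal0|rewrite subrr; apply: ideal0].
  move=> a u v /asboolP[kap hk hu] /asboolP[kap' hk' hv]; apply/asboolP.
  exists (a * kap + kap'); first by apply: idealD => //; apply: idealMl.
  suff -> : a * u + v - (a * kap + kap') = a * (u - kap) + (v - kap').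
    by apply: idealD => //; apply: idealMl.
  by ring.
have J_mod b : b \in J -> exists2 kap, kap \in K & b - kap \in ideal_mul irr J.
  move=> bJ; have /asboolP[kap hk hb] : b \in KJs 1%N.
    move: b bJ; apply: content_fg_min => // q.
    have [kap hk hq] := hpoly_mod_mJ hK KJ hr q; apply/asboolP; exists kap => //.
    move: hq; apply: ideal_mul_min; first exact: ideal_mul_closed.
    move=> a b airr bJ; apply: ideal_mul_mem => //.
    by rewrite -[a]mulr1; apply: ideal_mul_mem.
  exists kap => //; move: hb; apply: ideal_mul_min; first exact: ideal_mul_closed.
  move=> a c airr cJ; apply: ideal_mul_mem => //.
  by move: airr; apply: ideal_mul_subl; apply: irr_closed.
have J_KJs d : {subset J <= KJs d}.
  elim: d => [|d IHd] b bJ.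
    apply/asboolP; exists 0; first exact: ideal0.
    by rewrite subr0 -[b]mul1r; apply: ideal_mul_mem.
  have /asboolP[kap hk hb] := IHd b bJ; rewrite -[b](subrK kap).
  apply: (idealD (KJs_closed _)); last first.
    apply/asboolP; exists kap => //; rewrite subrr; apply: ideal0.
    exact: ideal_mul_closed.
  move: (b - kap) hb; apply: ideal_mul_min => // a c ad cJ.
  have [kap' hk' hc] := J_mod c cJ; apply/asboolP; exists (a * kap').
    exact: idealMl.
  rewrite -mulrBr mulrC.
  suff: c - kap' \in (fun z => z * a \in ideal_mul (ideal_exp irr d.+1) J) by [].
  move: (c - kap') hc; apply: ideal_mul_min.
    exact: ideal_closed_comp (ideal_mul_closed _ _).
  move=> a' c' a'irr c'J; rewrite unfold_in mulrAC.
  by apply: ideal_mul_mem => //; apply: ideal_mul_mem.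
move=> b /(J_KJs s)/asboolP[kap hk /K_colon hb].
by rewrite -(subrK kap b); apply: idealD.
Qed.

End MinimalReduction.

Theorem theorem1 (k : fieldType) (m n : nat) (hmn : (m <= n)%N) :
  let f := gen_f k m n in
  let g := gen_g k m n in
  let I := ideal_mul (content f) (content g) in
  let J := content (f * g) in
  [/\ is_minimal_reduction J I,
      has_analytic_spread I (m + n + 1)
    & is_reduction_number J I m]
  /\
  (alg_independent (@hpoly k m n) /\
   is_noether_normalization
     (gen_subalg (mem (codom (@hpoly k m n))))
     (gen_subalg (mem (codom (@xyprod k m n)))))
  /\
  (forall r : nat, (r < m)%N ->
     ~ (ideal_mul J (ideal_exp (content g) r)
          =i ideal_mul (content f) (ideal_exp (content g) r.+1))).
Proof.
move=> f g I J; have red : ideal_exp I m.+1 =i ideal_mul J (ideal_exp I m).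
  exact: I_exp_reduction.
have J_closed : ideal_closed J by apply: ideal_gen_closed.
(* This element lies in I^(r+1) and in c(f) c(g)^(r+1), whereas J I^r and J c(g)^r are contained in
   J; it refutes both equalities. *)
have sharp r : (r < m)%N ->
    ~ (@xvar k m n ord0 ^+ r.+1 * yvar k m ord_max ^+ r.+1 \in J).
  by move=> rm; apply/negP; apply: xy_power_notin_content.
split; last split.
- split; last 2 first.
  + exact: analytic_spread_I.
  + split=> // s hs; rewrite leqNgt; apply/negP => sm; apply: (sharp s sm).
    apply: (@ideal_mul_subl _ J (ideal_exp I s) J_closed); rewrite -hs.
    apply: ideal_expMl; first exact: xvar_content.
    by apply: ideal_exp_mem; apply: yvar_content.
  split; first by split; [|apply: J_sub_I|exists m].
  move=> K [hK _ [r hr]] KJ z; apply/idP/idP; first exact: KJ.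
  exact: (J_sub_reduction hK KJ hr).
- split; [exact: hpoly_alg_independent|exact: noether_normalization].
move=> r rm h; apply: (sharp r rm); rewrite exprSr -mulrA; apply: idealMl => //.
apply: (@ideal_mul_subl _ J (ideal_exp (content g) r) J_closed); rewrite h.
apply: ideal_mul_mem; first exact: xvar_content.
by apply: ideal_exp_mem; apply: yvar_content.
Qed.
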